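(* Let $(M,g)$ be a connected, $3$-dimensional Riemannian manifold of zero scalar curvature. Let $\mathcal{F}=\{f : \nabla^2 f=f\,\mathrm{Ric}\}$ be the vector space of static potentials on $(M,g)$ (together with the zero function). Then: (i) $\dim(\mathcal{F})\le 2$ unless $(M,g)$ is flat. (ii) If there exist two linearly independent functions $f_1,f_2\in\mathcal{F}$ such that $f_1^{-1}(0)\cap f_2^{-1}(0)\neq\emptyset$, then $(M,g)$ is flat.
   Context: $\nabla^2$ and $\mathrm{Ric}$ denote the Hessian and Ricci curvature of $g$; $g$ and functions in $\mathcal F$ are smooth. (When the scalar curvature is zero, the static equation $-(\Delta f)g+\nabla^2 f-f\,\mathrm{Ric}=0$ is equivalent to $\nabla^2 f=f\,\mathrm{Ric}$.) *)

(* Defs.v *)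
From HB Require Import structures.
From mathcomp Require Import all_boot all_order all_algebra.
From mathcomp Require Import all_classical all_reals all_analysis.

Set Implicit Arguments.
Unset Strict Implicit.
Unset Printing Implicit Defensive.

Import Order.TTheory GRing.Theory Num.Theory.
Import numFieldNormedType.Exports.

Local Open Scope classical_set_scope.
Local Open Scope ring_scope.

Definition partial (R : realType) (n : nat) (i : 'I_n) (f : 'rV[R]_n -> R) :
    'rV[R]_n -> R :=
  fun x => 'D_(delta_mx 0 i) f x.

(* [Ck k U f] is meant for open [U]; the values of [f] outside [U] then play
   no role, since both continuity and derivatives at a point of [U] are local. *)
Fixpoint Ck (R : realType) (n k : nat) (U : set 'rV[R]_n) (f : 'rV[R]_n -> R) :
    Prop :=
  {in U, continuous f} /\
  if k is k'.+1 then
    forall i : 'I_n, (forall x, U x -> derivable f x (delta_mx 0 i)) /\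
                     Ck k' U (partial i f)
  else True.

Definition smooth_on (R : realType) (n : nat) (U : set 'rV[R]_n)
    (f : 'rV[R]_n -> R) : Prop :=
  forall k : nat, Ck k U f.

Definition smooth_map_on (R : realType) (n m : nat) (U : set 'rV[R]_n)
    (F : 'rV[R]_n -> 'rV[R]_m) : Prop :=
  forall j : 'I_m, smooth_on U (fun x => F x 0 j).

(* A chart is a homeomorphism between an open set of [M] and
   an open set of R^n, given by two total functions that are only meaningful on
   [chart_dom] and [chart_cod] respectively. *)

Record chart (R : realType) (n : nat) (M : topologicalType) := Chart {
  chart_dom : set M;
  chart_cod : set 'rV[R]_n;
  chart_map : M -> 'rV[R]_n;
  chart_inv : 'rV[R]_n -> M;
  chart_dom_open : open chart_dom;
  chart_cod_open : open chart_cod;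
  chart_map_cod : forall p, chart_dom p -> chart_cod (chart_map p);
  chart_inv_dom : forall x, chart_cod x -> chart_dom (chart_inv x);
  chart_mapK : forall p, chart_dom p -> chart_inv (chart_map p) = p;
  chart_invK : forall x, chart_cod x -> chart_map (chart_inv x) = x;
  chart_map_continuous : {in chart_dom, continuous chart_map};
  chart_inv_continuous : {in chart_cod, continuous chart_inv}
}.

Definition transition (R : realType) (n : nat) (M : topologicalType)
    (c c' : chart R n M) : 'rV[R]_n -> 'rV[R]_n :=
  fun x => chart_map c' (chart_inv c x).

(* The domain of [transition c c'], as an open subset of [chart_cod c]. *)
Definition overlap (R : realType) (n : nat) (M : topologicalType)
    (c c' : chart R n M) : set 'rV[R]_n :=
  [set x | chart_cod c x /\ chart_dom c' (chart_inv c x)].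

(* The atlas is not required to be maximal: every smooth atlas determines its
   smooth structure. *)
Record smooth_manifold (R : realType) (n : nat) := SmoothManifold {
  carrier :> topologicalType;
  carrier_hausdorff : hausdorff_space carrier;
  carrier_second_countable : @second_countable carrier;
  atlas : set (chart R n carrier);
  atlas_cover : forall p : carrier, exists2 c, atlas c & chart_dom c p;
  atlas_smooth : forall c c', atlas c -> atlas c' ->
    smooth_map_on (overlap c c') (transition c c')
}.

Definition smooth_fun (R : realType) (n : nat) (M : smooth_manifold R n)
    (f : M -> R) : Prop :=
  forall c : chart R n M, atlas c ->
    smooth_on (chart_cod c) (fun x => f (chart_inv c x)).

(* A Riemannian metric, given by its components [metric_mx c x] in every chart
   [c] of the atlas at the point of coordinates [x]; [metric_transition] is the
   transformation law of a covariant 2-tensor. *)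
Record riemannian_metric (R : realType) (n : nat) (M : smooth_manifold R n) :=
  RiemannianMetric {
  metric_mx : chart R n M -> 'rV[R]_n -> 'M[R]_n;
  metric_smooth : forall c, atlas c -> forall i j : 'I_n,
    smooth_on (chart_cod c) (fun x => metric_mx c x i j);
  metric_sym : forall c x, atlas c -> chart_cod c x ->
    (metric_mx c x)^T = metric_mx c x;
  metric_posdef : forall c x (v : 'rV[R]_n), atlas c -> chart_cod c x ->
    v != 0 -> 0 < (v *m metric_mx c x *m v^T) 0 0;
  metric_transition : forall c c' x (i j : 'I_n), atlas c -> atlas c' ->
    overlap c c' x ->
    metric_mx c x i j =
      \sum_(k < n) \sum_(l < n)
        partial i (fun y => transition c c' y 0 k) x *
        partial j (fun y => transition c c' y 0 l) x *
        metric_mx c' (transition c c' x) k l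
}.

(* Gamma^k_(ij), for the components [G] of a metric in local coordinates. *)
Definition christoffel (R : realType) (n : nat) (G : 'rV[R]_n -> 'M[R]_n)
    (k i j : 'I_n) : 'rV[R]_n -> R :=
  fun x => 2^-1 * \sum_(l < n) invmx (G x) k l *
    (partial i (fun y => G y j l) x + partial j (fun y => G y i l) x
     - partial l (fun y => G y i j) x).

(* R^l_(kij), where R(d_i, d_j) d_k = \sum_l R^l_(kij) d_l and
   R(X, Y) = [nabla_X, nabla_Y] - nabla_[X, Y]. *)
Definition riemann (R : realType) (n : nat) (G : 'rV[R]_n -> 'M[R]_n)
    (l k i j : 'I_n) : 'rV[R]_n -> R :=
  fun x =>
    partial i (christoffel G l j k) x - partial j (christoffel G l i k) x
    + \sum_(m < n) (christoffel G l i m x * christoffel G m j k x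
                    - christoffel G l j m x * christoffel G m i k x).

(* Ric(Y, Z) = trace (X |-> R(X, Y) Z), which is positive on round spheres. *)
Definition ricci (R : realType) (n : nat) (G : 'rV[R]_n -> 'M[R]_n)
    (j k : 'I_n) : 'rV[R]_n -> R :=
  fun x => \sum_(i < n) riemann G i k i j x.

Definition scalar_curv (R : realType) (n : nat) (G : 'rV[R]_n -> 'M[R]_n) :
    'rV[R]_n -> R :=
  fun x => \sum_(j < n) \sum_(k < n) invmx (G x) j k * ricci G j k x.

Definition hessian (R : realType) (n : nat) (G : 'rV[R]_n -> 'M[R]_n)
    (f : 'rV[R]_n -> R) (i j : 'I_n) : 'rV[R]_n -> R :=
  fun x => partial i (partial j f) x
           - \sum_(k < n) christoffel G k i j x * partial k f x.

(* A tensor vanishes, or two tensors agree, on [M] exactly when their components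
   do so in all the charts of the atlas. *)

Definition flat (R : realType) (n : nat) (M : smooth_manifold R n)
    (g : riemannian_metric M) : Prop :=
  forall c x, atlas c -> chart_cod c x ->
    forall l k i j : 'I_n, riemann (metric_mx g c) l k i j x = 0.

Definition zero_scalar_curv (R : realType) (n : nat) (M : smooth_manifold R n)
    (g : riemannian_metric M) : Prop :=
  forall c x, atlas c -> chart_cod c x -> scalar_curv (metric_mx g c) x = 0.

Definition static_potentials (R : realType) (n : nat) (M : smooth_manifold R n)
    (g : riemannian_metric M) : set (M -> R) :=
  [set f | smooth_fun f /\
    forall c x, atlas c -> chart_cod c x -> forall i j : 'I_n,
      hessian (metric_mx g c) (fun y => f (chart_inv c y)) i j x =
      f (chart_inv c x) * ricci (metric_mx g c) i j x].

(* [\dim] needs a finite-dimensional ambient space, which [M -> R] is not. *)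
Definition lin_indep (R : realType) (V : lmodType R) (d : nat)
    (b : d.-tuple V) : Prop :=
  forall a : 'I_d -> R, \sum_(i < d) a i *: b`_i = 0 -> forall i, a i = 0.

Definition is_basis (R : realType) (V : lmodType R) (F : set V) (d : nat)
    (b : d.-tuple V) : Prop :=
  [/\ forall i : 'I_d, F b`_i,
      lin_indep b
    & forall v, F v -> exists a : 'I_d -> R, v = \sum_(i < d) a i *: b`_i].

Definition has_dim (R : realType) (V : lmodType R) (F : set V) (d : nat) :
    Prop :=
  exists b : d.-tuple V, is_basis F b.

(* Main.v *)
(* Commuting covariant derivatives in [Hess f = f Ric] and expressing the
   curvature of a scalar-flat 3-metric through Ricci gives
     2 (f_i R_jk - f_j R_ik) + R(df)_i g_jk - R(df)_j g_ik + f C_ijk = 0,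
   with [C] the Cotton tensor. Where [f = 0] this forces
   [R = mu (g - 3 n n)] with [n] the unit vector along [df]; two potentials
   vanishing at a point with independent differentials therefore force [R = 0]
   there. A potential is determined by its 1-jet at a point, so three independent
   potentials have two independent combinations vanishing at any given point:
   this is (i).
   For (ii), [w = f2 df1 - f1 df2] is a Killing field satisfying the identity
   above with [f = 0], so [R = mu (g - 3 w w / |w|^2)] where [w <> 0], and
   [div R = 0] (the trace of the identity) makes [mu |w|^3] locally constant.
   Hence [R(w, w)^2 |w|^2] is constant, and it is zero at the common zero of [f1]
   and [f2]. So [R = 0] where [w <> 0], and [w = 0] only at common zeros of [f1]
   and [f2], where [R = 0] as well. *)
Require Import Defs.
From HB Require Import structures.
From mathcomp Require Import all_boot all_order all_algebra.
From mathcomp Require Import all_classical all_reals all_analysis.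
From mathcomp Require Import ring lra.

Set Implicit Arguments.
Unset Strict Implicit.
Unset Printing Implicit Defensive.

Import Order.TTheory GRing.Theory Num.Theory.
Import numFieldNormedType.Exports.

Local Open Scope classical_set_scope.
Local Open Scope ring_scope.

(** * Smooth functions *)

(** The function [mu |w|^3] involves a square root, and [mu] has no meaning where [w = 0], which is
    exactly where its value is wanted. Four times its square is [R(w, w)^2 |w|^2], polynomial in [w]
    and in the Ricci and inverse metric components: it is smooth on the whole chart and stationary
    at the zeros of [w] too, so it can be followed through them. The trace of the identity only
    gives [f div R = 0], hence [div R = 0] where some potential is nonzero. This covers all points
    with [w <> 0], and the divergence is used nowhere else. Tensors are families of components in
    charts. What crosses from one chart to another is the vanishing of a potential or of this
    invariant, never the value of a curvature component. Index computations are kept short by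
    letting covectors be rows and the Christoffel symbols of a fixed direction be a matrix;
    commuting derivatives is then matrix algebra. *)

Section SmoothFunctions.
Variables (R : realType) (n : nat) (U : set 'rV[R]_n).
Hypothesis oU : open U.
Implicit Types (f g : 'rV[R]_n -> R) (i j : 'I_n) (x : 'rV[R]_n).

Lemma near_open_eq f g x : (forall y, U y -> f y = g y) -> U x ->
  \forall y \near x, f y = g y.
Proof.
move=> fg Ux; have : nbhs x U by exact: open_nbhs_nbhs.
by apply: filterS => y; exact: fg.
Qed.

Lemma partial_ext f g i x : (forall y, U y -> f y = g y) -> U x ->
  partial i f x = partial i g x.
Proof. by move=> fg Ux; apply: near_eq_derive; exact: near_open_eq. Qed.

Lemma Ck_ext k f g : (forall x, U x -> f x = g x) -> Ck k U f -> Ck k U g.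
Proof.
have cE f0 g0 : (forall x, U x -> f0 x = g0 x) ->
    {in U, continuous f0} -> {in U, continuous g0}.
  move=> fg cf x xU; have Ux := set_mem xU.
  rewrite /continuous_at -(fg x Ux); apply: cvg_trans (cf x xU).
  apply: near_eq_cvg; first exact: (nbhs_filter x).
  exact: (near_open_eq fg Ux).
elim: k f g => [|k IH] f g fg /= [cf df]; first by split=> //; exact: cE fg cf.
split; first exact: cE fg cf.
move=> i; have [dfi Cfi] := df i; split.
  by move=> x Ux; apply: near_eq_derivable (dfi x Ux); exact: near_open_eq.
by apply: IH Cfi => x Ux; exact: partial_ext.
Qed.

Lemma CkW k f : Ck k.+1 U f -> Ck k U f.
Proof.
elim: k f => [|k IH] f /= [cf df] //; split=> // i.
by have [dfi Cfi] := df i; split => //; exact: IH.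
Qed.

Lemma Ck_cst k (a : R) : Ck k U (fun=> a).
Proof.
elim: k a => [|k IH] a /=; first by split=> // x _; exact: cst_continuous.
split; first by move=> x _; exact: cst_continuous.
move=> i; split; first by move=> x _; exact: derivable_cst.
apply: Ck_ext (IH 0) => x _.
by rewrite /partial derive_cst.
Qed.

Lemma Ck_add k f g : Ck k U f -> Ck k U g -> Ck k U (fun x => f x + g x).
Proof.
elim: k f g => [|k IH] f g /= [cf df] [cg dg].
  by split=> // x Ux; apply: continuousD; [exact: cf|exact: cg].
split; first by move=> x Ux; apply: continuousD; [exact: cf|exact: cg].
move=> i; have [dfi Cfi] := df i; have [dgi Cgi] := dg i; split.
  by move=> x Ux; apply: derivableD; [exact: dfi|exact: dgi].
apply: Ck_ext (IH _ _ Cfi Cgi) => x Ux.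
by rewrite /partial deriveD //; [exact: dfi|exact: dgi].
Qed.

Lemma Ck_mul k f g : Ck k U f -> Ck k U g -> Ck k U (fun x => f x * g x).
Proof.
elim: k f g => [|k IH] f g Cf Cg.
  case: Cf Cg => [cf _] [cg _].
  by split=> // x Ux; apply: continuousM; [exact: cf|exact: cg].
(* In the product rule each derivative, of order [k], meets an undifferentiated factor, which has to
   be lowered to the same order. *)
have Cf' := CkW Cf; have Cg' := CkW Cg.
case: Cf Cg => [cf df] [cg dg].
split; first by move=> x Ux; apply: continuousM; [exact: cf|exact: cg].
move=> i; have [dfi Cfi] := df i; have [dgi Cgi] := dg i; split.
  by move=> x Ux; apply: derivableM; [exact: dfi|exact: dgi].
apply: Ck_ext (Ck_add (IH _ _ Cf' Cgi) (IH _ _ Cg' Cfi)) => x Ux.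
by rewrite /partial deriveM //; [exact: dfi|exact: dgi].
Qed.

Lemma Ck_inv k f : (forall x, U x -> f x != 0) -> Ck k U f ->
  Ck k U (fun x => (f x)^-1).
Proof.
move=> f0; elim: k => [|k IH] Cf.
  case: Cf => cf _; split=> // x Ux; apply: continuousV; last exact: cf.
  exact/f0/set_mem.
have Cif := IH (CkW Cf); case: Cf => [cf df]; split.
  move=> x Ux; apply: continuousV; last exact: cf.
  exact/f0/set_mem.
move=> i; have [dfi Cfi] := df i; split.
  by move=> x Ux; apply: derivableV; [exact: f0|exact: dfi].
apply: Ck_ext (Ck_mul (Ck_cst _ (-1)) (Ck_mul (Ck_mul Cif Cif) Cfi)) => x Ux.
rewrite /partial deriveV; [|exact: f0|exact: dfi].
by rewrite -expr2 exprVn /GRing.scale /= mulN1r mulNr.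
Qed.

Lemma smooth_ext f g : (forall x, U x -> f x = g x) ->
  smooth_on U f -> smooth_on U g.
Proof. by move=> fg sf k; exact: Ck_ext fg (sf k). Qed.

Lemma smooth_cst (a : R) : smooth_on U (fun=> a).
Proof. by move=> k; exact: Ck_cst. Qed.

Lemma smoothD f g : smooth_on U f -> smooth_on U g ->
  smooth_on U (fun x => f x + g x).
Proof. by move=> sf sg k; exact: Ck_add. Qed.

Lemma smoothM f g : smooth_on U f -> smooth_on U g ->
  smooth_on U (fun x => f x * g x).
Proof. by move=> sf sg k; exact: Ck_mul. Qed.

Lemma smoothN f : smooth_on U f -> smooth_on U (fun x => - f x).
Proof.
move=> sf; apply: smooth_ext (smoothM (smooth_cst (-1)) sf) => x _.
by rewrite mulN1r.
Qed.

Lemma smoothB f g : smooth_on U f -> smooth_on U g ->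
  smooth_on U (fun x => f x - g x).
Proof. by move=> sf /smoothN; exact: smoothD. Qed.

Lemma smoothV f : (forall x, U x -> f x != 0) -> smooth_on U f ->
  smooth_on U (fun x => (f x)^-1).
Proof. by move=> f0 sf k; exact: Ck_inv. Qed.

Lemma smooth_sum (I : Type) (r : seq I) (P : pred I) (F : I -> 'rV[R]_n -> R) :
  (forall a, smooth_on U (F a)) ->
  smooth_on U (fun x => \sum_(a <- r | P a) F a x).
Proof.
move=> sF; elim: r => [|a r IH].
  by apply: smooth_ext (smooth_cst 0) => x _; rewrite big_nil.
case Pa: (P a).
  by apply: smooth_ext (smoothD (sF a) IH) => x _; rewrite big_cons Pa.
by apply: smooth_ext IH => x _; rewrite big_cons Pa.
Qed.

Lemma smooth_prod (I : Type) (r : seq I) (F : I -> 'rV[R]_n -> R) :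
  (forall a, smooth_on U (F a)) ->
  smooth_on U (fun x => \prod_(a <- r) F a x).
Proof.
move=> sF; elim: r => [|a r IH].
  by apply: smooth_ext (smooth_cst 1) => x _; rewrite big_nil.
by apply: smooth_ext (smoothM (sF a) IH) => x _; rewrite big_cons.
Qed.

Lemma smooth_partial i f : smooth_on U f -> smooth_on U (partial i f).
Proof. by move=> sf k; have [_ /(_ i) []] := sf k.+1. Qed.

Lemma smooth_derivable f i x : smooth_on U f -> U x ->
  derivable f x (delta_mx 0 i).
Proof. by move=> sf; have [_ /(_ i) [+ _]] := sf 1%N; apply. Qed.

Lemma smooth_continuous f x : smooth_on U f -> U x -> {for x, continuous f}.
Proof. by move=> sf Ux; have [+ _] := sf 0%N; apply; exact: mem_set. Qed.

Lemma partial_cst (a : R) i x : partial i (fun=> a) x = 0.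
Proof. exact: derive_cst. Qed.

Lemma partialD f g i x : smooth_on U f -> smooth_on U g -> U x ->
  partial i (fun y => f y + g y) x = partial i f x + partial i g x.
Proof.
by move=> sf sg Ux; rewrite /partial deriveD //; exact: smooth_derivable Ux.
Qed.

Lemma partialM f g i x : smooth_on U f -> smooth_on U g -> U x ->
  partial i (fun y => f y * g y) x = partial i f x * g x + f x * partial i g x.
Proof.
move=> sf sg Ux; rewrite /partial deriveM //; try exact: smooth_derivable Ux.
by rewrite addrC /GRing.scale /= [g x * _]mulrC.
Qed.

Lemma partialN f i x : smooth_on U f -> U x ->
  partial i (fun y => - f y) x = - partial i f x.
Proof.
by move=> sf Ux; rewrite /partial deriveN //; exact: smooth_derivable Ux.
Qed.

Lemma partialB f g i x : smooth_on U f -> smooth_on U g -> U x ->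
  partial i (fun y => f y - g y) x = partial i f x - partial i g x.
Proof. by move=> sf sg Ux; rewrite partialD ?partialN //; exact: smoothN. Qed.

Lemma partial_sum (I : Type) (r : seq I) (F : I -> 'rV[R]_n -> R) i x :
  (forall a, smooth_on U (F a)) -> U x ->
  partial i (fun y => \sum_(a <- r) F a y) x = \sum_(a <- r) partial i (F a) x.
Proof.
move=> sF Ux; elim: r => [|a r IH].
  rewrite big_nil -[RHS](partial_cst 0 i x); congr partial.
  by apply/funext => y; rewrite big_nil.
rewrite big_cons -IH -partialD //; last exact: smooth_sum.
by congr partial; apply/funext => y; rewrite big_cons.
Qed.

End SmoothFunctions.

(** * Boxes and axis-parallel segments *)

Section Boxes.
Variables (R : realType) (n : nat).
Implicit Types (x y z : 'rV[R]_n) (r : R) (i j : 'I_n).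

(** The sup-norm ball spelled out in coordinates, the shape in which axis-parallel segments between
    its points visibly stay inside. *)
Definition box x r : set 'rV[R]_n := [set y | forall j, `|y 0 j - x 0 j| < r].

Lemma nbhs_box x (A : set 'rV[R]_n) :
  nbhs x A -> exists2 r, 0 < r & box x r `<=` A.
Proof.
move=> /nbhs_ballP[r /= r0 rA]; exists r => // y yx; apply: rA; split=> //.
by move=> i j; rewrite (ord1 i) /ball /= distrC.
Qed.

Lemma box_nbhs x r : 0 < r -> nbhs x (box x r).
Proof.
move=> r0; apply/nbhs_ballP; exists r => // y [_ yx] j.
by have := yx 0 j; rewrite /ball /= distrC.
Qed.

Lemma box_center x r : 0 < r -> box x r x.
Proof. by move=> r0 j; rewrite subrr normr0. Qed.

Lemma axisE y i j (t : R) :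
  (t *: delta_mx 0 i + y) 0 j = (if j == i then t else 0) + y 0 j.
Proof. by rewrite !mxE eqxx /=; case: (j == i); rewrite ?mulr1 ?mulr0. Qed.

Lemma box_axis x r y i (t s : R) : box x r y ->
  box x r (t *: delta_mx 0 i + y) -> Num.min 0 t <= s <= Num.max 0 t ->
  box x r (s *: delta_mx 0 i + y).
Proof.
move=> yx tyx /andP[s1 s2] j; have := tyx j; have := yx j; rewrite !axisE.
case: eqP => [ji|_]; last by rewrite !add0r.
move: s1 s2; rewrite /Num.min /Num.max; case: ltP => t0 s1 s2;
  rewrite !ltr_norml => /andP[a1 a2] /andP[b1 b2]; apply/andP; split; lra.
Qed.

(* Two points of a box are joined inside it by segments parallel to the axes. *)
Lemma box_ind x r (P : set 'rV[R]_n) :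
  (forall y i (t : R), box x r y -> box x r (t *: delta_mx 0 i + y) ->
     P y -> P (t *: delta_mx 0 i + y)) ->
  forall y z, box x r y -> box x r z -> P y -> P z.
Proof.
move=> Pstep y z yx zx Py.
pose w k := \row_j (if (j < k)%N then z 0 j else y 0 j).
have wx k : box x r (w k) by move=> j; rewrite mxE; case: ifP.
suff Pw k : (k <= n)%N -> P (w k).
  have <- : w n = z by apply/rowP => j; rewrite mxE ltn_ord.
  exact: Pw.
elim: k => [_|k IH kn].
  by have -> : w 0%N = y by apply/rowP => j; rewrite mxE.
have wS : w k.+1 =
    (z 0 (Ordinal kn) - y 0 (Ordinal kn)) *: delta_mx 0 (Ordinal kn) + w k.
  apply/rowP => j; rewrite axisE !mxE ltnS leq_eqVlt.
  case: (eqVneq j (Ordinal kn)) => [->|jk] /=.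
    by rewrite eqxx ltnn /= subrK.
  by rewrite add0r; move: jk; rewrite -val_eqE /= => /negPf ->.
rewrite wS; apply: Pstep => //; first by rewrite -wS.
exact/IH/ltnW.
Qed.

Lemma continuous_near (f : 'rV[R]_n -> R) x r : {for x, continuous f} -> 0 < r ->
  nbhs x [set y | `|f x - f y| < r].
Proof.
move=> cf r0; have := (cvgrPdist_lt _ _).1 cf.
by move=> /(_ (nbhs_filter x)); apply.
Qed.

End Boxes.

Section Lines.
Variables (R : realType) (n : nat) (U : set 'rV[R]_n).
Implicit Types (f g : 'rV[R]_n -> R) (i j : 'I_n) (x y : 'rV[R]_n).

Lemma line_is_derive f i y (t : R) : smooth_on U f ->
  U (t *: delta_mx 0 i + y) ->
  is_derive t 1 (fun s : R => f (s *: delta_mx 0 i + y))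
    (partial i f (t *: delta_mx 0 i + y)).
Proof.
move=> sf Ut.
have E : (fun h : R => h^-1 *: (f ((h *: 1 + t) *: delta_mx 0 i + y) -
     f (t *: delta_mx 0 i + y))) =
  (fun h : R => h^-1 *: (f (h *: delta_mx 0 i + (t *: delta_mx 0 i + y)) -
     f (t *: delta_mx 0 i + y))).
  apply/funext => h; congr (_ *: (f _ - _)).
  by rewrite scalerDl addrA -scalerA scale1r.
apply: DeriveDef.
  rewrite /derivable /= E.
  exact: (smooth_derivable sf Ut).
by rewrite /partial /derive /= E.
Qed.

(** The bounds [Num.min 0 t] and [Num.max 0 t] treat both signs of [t] at once, since paths made of
    axis steps go in either direction. *)
Lemma axis_MVT f i y (t : R) : smooth_on U f ->
  (forall s : R, Num.min 0 t <= s <= Num.max 0 t ->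
     U (s *: delta_mx 0 i + y)) ->
  exists2 s : R, Num.min 0 t <= s <= Num.max 0 t &
    f (t *: delta_mx 0 i + y) - f y =
      partial i f (s *: delta_mx 0 i + y) * t.
Proof.
move=> sf Us.
pose g (s : R) := f (s *: delta_mx 0 i + y).
have dg (s : R) : Num.min 0 t <= s <= Num.max 0 t ->
    is_derive s 1 g (partial i f (s *: delta_mx 0 i + y)).
  by move=> st; apply: line_is_derive => //; exact: Us.
have g0 : g 0 = f y by rewrite /g scale0r add0r.
have cg : {within `[Num.min 0 t, Num.max 0 t], continuous g}.
  by apply: derivable_within_continuous => s; rewrite in_itv /= => /dg [].
have [t0|t0] := ltP 0 t.
  have [||s] := @MVT_segment R g (fun s => partial i f (s *: delta_mx 0 i + y)) 0 t (ltW t0).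
  - move=> s; rewrite in_itv /= => /andP[s0 st]; apply: dg.
    by rewrite min_l ?max_r ?ltW.
  - by move: cg; rewrite min_l ?max_r ?ltW.
  - rewrite in_itv /= => st.
    by rewrite subr0 g0 => gt; exists s.
have [||s] := @MVT_segment R g (fun s => partial i f (s *: delta_mx 0 i + y)) t 0 t0.
- move=> s; rewrite in_itv /= => /andP[s0 st]; apply: dg.
  by rewrite min_r // max_l // (ltW s0) (ltW st).
- by move: cg; rewrite min_r // max_l.
- rewrite in_itv /= => st.
  rewrite g0 sub0r => gt; exists s => //.
  by rewrite -opprB gt mulrN opprK.
Qed.

Lemma partial0_box f x r : box x r `<=` U -> smooth_on U f ->
  (forall y i, box x r y -> partial i f y = 0) ->
  forall y z, box x r y -> box x r z -> f z = f y.
Proof.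
move=> bU sf df0 y z yx zx.
apply: (box_ind (P := [set z | f z = f y])) yx zx _ => //= w i t wx twx <-.
apply/eqP; rewrite -subr_eq0.
have bs s : Num.min 0 t <= s <= Num.max 0 t -> box x r (s *: delta_mx 0 i + w).
  exact: box_axis.
have [|s /bs st ->] := @axis_MVT f i w t sf; first by move=> s /bs /bU.
by rewrite df0 // mul0r.
Qed.

End Lines.

(** * Commuting partial derivatives and the chain rule *)

Section Clairaut.
Variables (R : realType) (n : nat) (U : set 'rV[R]_n).
Hypothesis oU : open U.
Implicit Types (f g : 'rV[R]_n -> R) (i j : 'I_n) (x y : 'rV[R]_n).

(* Second difference quotient, by the mean value theorem in each variable. *)
Lemma second_difference f i j x r (h : R) : smooth_on U f ->
  box x r `<=` U -> 0 < h -> h + h < r ->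
  exists2 z, box x r z &
    f (h *: delta_mx 0 i + (h *: delta_mx 0 j + x)) - f (h *: delta_mx 0 j + x)
    - (f (h *: delta_mx 0 i + x) - f x) = partial j (partial i f) z * h * h.
Proof.
move=> sf bU h0 hr.
have inb s t : 0 <= s <= h -> 0 <= t <= h ->
    box x r (s *: delta_mx 0 i + (t *: delta_mx 0 j + x)).
  move=> /andP[s0 sh] /andP[t0 th] k; rewrite !axisE.
  by rewrite ltr_norml; apply/andP; split; case: (k == i); case: (k == j); lra.
have sw s t : s *: delta_mx 0 i + (t *: delta_mx 0 j + x) =
    t *: delta_mx 0 j + (s *: delta_mx 0 i + x) by rewrite addrCA.
have hh : 0 <= h <= h by rewrite lexx ltW.
have h00 : 0 <= (0 : R) <= h by rewrite lexx ltW.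
pose D (s : R) := f (s *: delta_mx 0 i + (h *: delta_mx 0 j + x)) -
                  f (s *: delta_mx 0 i + x).
pose dD (s : R) := partial i f (s *: delta_mx 0 i + (h *: delta_mx 0 j + x)) -
                   partial i f (s *: delta_mx 0 i + x).
have dDP s : 0 <= s <= h -> is_derive s 1 D (dD s).
  move=> sh.
  have d1 : is_derive s 1 (fun s => f (s *: delta_mx 0 i + (h *: delta_mx 0 j + x)))
      (partial i f (s *: delta_mx 0 i + (h *: delta_mx 0 j + x))).
    by apply: line_is_derive => //; apply/bU/inb.
  have d2 : is_derive s 1 (fun s => f (s *: delta_mx 0 i + x))
      (partial i f (s *: delta_mx 0 i + x)).
    apply: line_is_derive => //; apply: bU.
    by have := inb s 0 sh h00; rewrite scale0r add0r.
  exact: is_deriveB d1 d2.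
have [||s] := @MVT_segment R D dD 0 h (ltW h0).
- by move=> s; rewrite in_itv /= => /andP[s0 sh]; apply: dDP; rewrite !ltW.
- by apply: derivable_within_continuous => s; rewrite in_itv /= => /dDP [].
rewrite in_itv /= => sh.
rewrite {1 2}/D !scale0r !add0r subr0 => Dh.
have [t' t'h|t th] := @axis_MVT _ _ U (partial i f) j (s *: delta_mx 0 i + x) h
  (smooth_partial i sf).
  rewrite -sw; apply/bU/inb => //.
  by move: t'h; rewrite (min_l (ltW h0)) (max_r (ltW h0)).
rewrite -sw /dD in Dh * => Dt.
exists (t *: delta_mx 0 j + (s *: delta_mx 0 i + x)).
  rewrite -sw; apply: inb => //.
  by move: th; rewrite (min_l (ltW h0)) (max_r (ltW h0)).
rewrite -Dt -Dh; ring.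
Qed.

(** The second difference is symmetric in [i] and [j], so it equates the two mixed partials at two
    points of an arbitrarily small box; continuity of both at [x] concludes. *)
Lemma partialC f i j x : smooth_on U f -> U x ->
  partial i (partial j f) x = partial j (partial i f) x.
Proof.
move=> sf Ux.
apply/eqP; rewrite -subr_eq0 -normr_le0; apply/ler_addgt0Pl => e e0.
rewrite addr0.
have c1 : {for x, continuous (partial i (partial j f))}.
  by apply: smooth_continuous Ux; do 2 apply: smooth_partial.
have c2 : {for x, continuous (partial j (partial i f))}.
  by apply: smooth_continuous Ux; do 2 apply: smooth_partial.
have e20 : 0 < e / 2 by lra.
have N : nbhs x [set y | [/\ U y,
   `|partial i (partial j f) x - partial i (partial j f) y| < e / 2 &
   `|partial j (partial i f) x - partial j (partial i f) y| < e / 2]].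
  have n1 := continuous_near c1 e20.
  have n2 := continuous_near c2 e20.
  have n3 : nbhs x U by exact: open_nbhs_nbhs.
  apply: (filterS _ (filterI n3 (filterI n1 n2))) => y [Uy [d1 d2]].
  exact: And3 Uy d1 d2.
have [r r0 rN] := nbhs_box N.
have bU : box x r `<=` U by move=> y /rN [].
have h0 : 0 < r / 4 by lra.
have hr : r / 4 + r / 4 < r by lra.
have [z1 z1b E1] := second_difference i j sf bU h0 hr.
have [z2 z2b E2] := second_difference j i sf bU h0 hr.
have [_ a1 _] := rN _ z2b.
have [_ _ a2] := rN _ z1b.
have E : partial j (partial i f) z1 = partial i (partial j f) z2.
  have hn : r / 4 != 0 by rewrite gt_eqF.
  move: E1 E2; move: (partial j _ z1) (partial i _ z2) => p q E1 E2.
  suff : p * (r / 4) * (r / 4) = q * (r / 4) * (r / 4) by move=> /(mulIf hn) /(mulIf hn).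
  rewrite -E1 -E2 [X in f X - _ - _ = _]addrCA.
  move: (f _) => a; move: (f _) => b; move: (f _) => c; move: (f _) => d; ring.
rewrite E in a2.
move: (partial i _ x) (partial j _ x) (partial i _ z2) a1 a2 => A B C.
clear - e0; rewrite !ltr_norml ler_norml => /andP[? ?] /andP[? ?]; apply/andP; split; lra.
Qed.

End Clairaut.

Section ChainRule.
Variables (R : realType) (n : nat).

(** The candidate differential, with [c] the row of partial derivatives. It is packed as a linear
    map in order to be compared with ['d f y] through [diff_unique]. *)
Let lincomb (c v : 'rV[R]_n) : R := \sum_k v 0 k * c 0 k.

Let lincomb_linear c : linear (lincomb c).
Proof.
move=> a u v; rewrite /lincomb scaler_sumr -big_split /=.
by apply: eq_bigr => k _; rewrite !mxE mulrDl /GRing.scale /= mulrA.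
Qed.

Let lincomb_mixin c :=
  GRing.isLinear.Build R 'rV[R]_n R *:%R (lincomb c) (lincomb_linear c).

Let lincombL c : {linear 'rV[R]_n -> R} := HB.pack (lincomb c) (lincomb_mixin c).

(** From [y] to [v + y] one coordinate is changed at a time. The mean value theorem on each step
    gives a partial derivative at a nearby point, within [d] of its value at [y]. *)
Lemma smooth_increment (U : set 'rV[R]_n) (f : 'rV[R]_n -> R) y (e : R) :
  open U -> smooth_on U f -> U y -> 0 < e ->
  \forall v \near (0 : 'rV[R]_n),
    `|f (v + y) - f y - \sum_k v 0 k * partial k f y| <= e * `|v|.
Proof.
move=> oU sf Uy e0.
(* The [n] steps each cost [d * |v|]; dividing by [n.+1] rather than [n] keeps the quotient
   meaningful for [n = 0]. *)
pose d := e / n.+1%:R.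
have d0 : 0 < d by rewrite divr_gt0.
have N : nbhs y [set z | U z /\
    forall k : 'I_n, `|partial k f y - partial k f z| < d].
  have n1 : nbhs y U by exact: open_nbhs_nbhs.
  apply: (filterI n1); apply: (@filter_forall _ _ _ (nbhs y)) => k.
  have ck : {for y, continuous (partial k f)}.
    by apply: smooth_continuous Uy; apply: smooth_partial.
  exact: continuous_near ck d0.
have [r r0 rN] := nbhs_box N.
apply/nbhs_ballP; exists r => // v [_ vr].
have {}vr k : `|v 0 k| < r.
  by have := vr 0 k; rewrite /ball /= mxE sub0r normrN.
have vn k : `|v 0 k| <= `|v|.
  rewrite [leRHS]/Num.Def.normr /= mx_normrE.
  exact: (le_bigmax _ (fun i : 'I_1 * 'I_n => `|v i.1 i.2|) (0, k)).
pose w k := \row_(j < n) ((if (j < k)%N then v 0 j else 0) + y 0 j).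
have wb k : box y r (w k).
  move=> j; rewrite mxE addrK; case: ifP => // _; by rewrite normr0.
suff H k : (k <= n)%N ->
    `|f (w k) - f y - \sum_(j < n | (j < k)%N) v 0 j * partial j f y|
      <= d * `|v| * k%:R.
  have := H n (leqnn n).
  have -> : w n = v + y by apply/rowP => j; rewrite !mxE ltn_ord.
  rewrite (eq_bigl xpredT); last by move=> j; rewrite ltn_ord.
  move=> /le_trans; apply; rewrite mulrAC ler_wpM2r //.
  by rewrite /d -mulrA ler_piMr ?(ltW e0) // mulrC ler_pdivrMr // mul1r ler_nat.
elim: k => [_|k IH kn].
  have -> : w 0%N = y by apply/rowP => j; rewrite mxE ltn0 add0r.
  by rewrite big_pred0 // !subrr normr0 mulr0.
pose o := Ordinal kn.
have wS : w k.+1 = v 0 o *: delta_mx 0 o + w k.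
  apply/rowP => j; rewrite axisE !mxE ltnS leq_eqVlt.
  case: (eqVneq j o) => [->|jk] /=; first by rewrite eqxx ltnn /= add0r.
  by rewrite add0r; move: jk; rewrite -val_eqE /= => /negPf ->.
have bs s : Num.min 0 (v 0 o) <= s <= Num.max 0 (v 0 o) ->
    box y r (s *: delta_mx 0 o + w k).
  by apply: box_axis => //; rewrite -wS.
have [|s /bs sb fE] := @axis_MVT _ _ U f o (w k) (v 0 o) sf.
  by move=> s /bs /rN [].
rewrite -wS in fE.
rewrite (bigD1 o) //= (eq_bigl (fun j : 'I_n => (j < k)%N)); last first.
  move=> j; rewrite ltnS leq_eqVlt -val_eqE /=.
  by case: (ltngtP j k) => //=; rewrite ?andbF ?andbT.
have := IH (ltnW kn); have [_ /(_ o)] := rN _ sb.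
set S := \sum_(j < n | _) _; set p := partial o f y; set q := partial o f _.
move: fE; rewrite -/q; set a := f (w k.+1); set b := f (w k).
move=> fE pq ih.
have -> : a - f y - (v 0 o * p + S) = (b - f y - S) + (q - p) * v 0 o.
  have -> : a = b + q * v 0 o by rewrite -fE; ring.
  ring.
rewrite -natr1 mulrDr mulr1; apply: le_trans (ler_normD _ _) _.
apply: lerD => //; rewrite normrM ler_pM //.
by rewrite distrC ltW.
Qed.

Lemma smooth_differentiable (U : set 'rV[R]_n) (f : 'rV[R]_n -> R) y :
  open U -> smooth_on U f -> U y ->
  differentiable f y /\
  (forall v, 'd f y v = \sum_k v 0 k * partial k f y).
Proof.
move=> oU sf Uy.
pose c := \row_k partial k f y.
have lE v : lincombL c v = \sum_k v 0 k * partial k f y.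
  by apply: eq_bigr => k _; rewrite mxE.
have cL : continuous (lincombL c).
  move=> v.
  apply: differentiable_continuous; rewrite /= /lincomb.
  elim: (index_enum _) => [|k s IH].
    have -> : (fun u : 'rV[R]_n => \sum_(k <- [::]) u 0 k * c 0 k) = cst (0 : R).
      by apply/funext => u; rewrite big_nil.
    exact: differentiable_cst.
  have -> : (fun u : 'rV[R]_n => \sum_(k <- k :: s) u 0 k * c 0 k) =
      (fun u => u 0 k * c 0 k) + (fun u => \sum_(k <- s) u 0 k * c 0 k).
    by apply/funext => u; rewrite big_cons.
  apply: differentiableD => //.
  by apply: differentiableM; [exact: differentiable_coord|exact: differentiable_cst].
have fE e : 0 < e -> \forall v \near (0 : 'rV[R]_n),
    `|f (v + y) - (f y + lincombL c v)| <= e * `|v|.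
  move=> e0; apply: filterS (smooth_increment oU sf Uy e0) => v.
  by rewrite -lE opprD addrA.
have dE : 'd f y = lincombL c :> ('rV[R]_n -> R).
  by apply: diff_unique => //; apply/eqaddoP => e /fE.
split; first by apply/diff_locallyP; rewrite dE; split=> //; apply/eqaddoP => e /fE.
by move=> v; rewrite dE lE.
Qed.

(** Only the curve [h |-> T (h e_i + x)] enters, so the differential of [f] is composed with a
    derivative in one variable. *)
Lemma partial_comp (m : nat) (V : set 'rV[R]_m) (U : set 'rV[R]_n)
    (T : 'rV[R]_m -> 'rV[R]_n) (f : 'rV[R]_n -> R) (i : 'I_m) x :
  open V -> open U -> smooth_map_on V T -> smooth_on U f -> V x -> U (T x) ->
  partial i (fun y => f (T y)) x =
    \sum_k partial i (fun y => T y 0 k) x * partial k f (T x).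
Proof.
move=> oV oU sT sf Vx UTx.
pose g (h : R) := T (h *: delta_mx 0 i + x).
have g0 : g 0 = T x by rewrite /g scale0r add0r.
have dg k : is_derive (0 : R) 1 (fun h => g h 0 k) (partial i (fun y => T y 0 k) x).
  have := @line_is_derive _ _ V (fun y => T y 0 k) i x 0 (sT k).
  by rewrite scale0r add0r; apply.
have gd : derivable g 0 1.
  by apply/derivable_mxP => a k; rewrite (ord1 a); case: (dg k).
have g1 : 'D_1 g 0 = \row_k partial i (fun y => T y 0 k) x.
  rewrite derive_mx //; apply/matrixP => a k; rewrite !mxE (ord1 a).
  by have [_ ->] := dg k.
have gdiff : differentiable g 0 by apply/derivable1_diffP.
have [fd fdE] := smooth_differentiable oU sf UTx.
rewrite /partial.
transitivity ('D_1 (f \o g) 0).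
  have E : (fun h : R => h^-1 *: (((fun y => f (T y)) \o shift x) (h *: delta_mx 0 i)
        - f (T x))) =
      (fun h : R => h^-1 *: (((f \o g) \o shift 0) (h *: 1) - (f \o g) 0)).
    by apply/funext => h /=; rewrite /g addr0 scale0r add0r [h%:A]mulr1.
  by rewrite /derive E.
have fd' : differentiable f (g 0) by rewrite g0.
rewrite deriveE; last exact: differentiable_comp.
rewrite (diff_comp gdiff fd') /=.
rewrite -(deriveE (1 : R) gdiff) g1 g0 fdE.
by apply: eq_bigr => k _; rewrite mxE.
Qed.

End ChainRule.

(** * Unique continuation *)

Section Gronwall.
Variable R : realType.

(** For [t >= 0] the weighted function [N s * expR (- L * s)] is nonincreasing, and for [t < 0] the
    function [N s * expR (L * s)] is nondecreasing. In both cases its value at [t] is at most its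
    value at [0]. *)
Lemma gronwall0 (N dN : R -> R) (L t : R) :
  (forall s, Num.min 0 t <= s <= Num.max 0 t ->
     [/\ is_derive s 1 N (dN s), 0 <= N s & `|dN s| <= L * N s]) ->
  N 0 = 0 -> N t = 0.
Proof.
move=> NP N0.
have dE (c s : R) : is_derive s 1 (fun s => expR (c * s)) (c * expR (c * s)).
  have dc : is_derive s 1 ( *:%R c : R -> R) c.
    by have := is_deriveZ c (is_derive_id s (1 : R)); rewrite [c%:A]mulr1.
  rewrite mulrC; exact: (is_derive1_comp (is_derive_expR (c * s)) dc).
have dM (c s : R) : Num.min 0 t <= s <= Num.max 0 t ->
    is_derive s 1 (fun s => N s * expR (c * s)) ((dN s + c * N s) * expR (c * s)).
  move=> /NP [d _ _]; have := is_deriveM d (dE c s).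
  move/is_derive_eq; apply; rewrite /GRing.scale /=; ring.
have cM (c : R) : {within `[Num.min 0 t, Num.max 0 t],
    continuous (fun s => N s * expR (c * s))}.
  by apply: derivable_within_continuous => s; rewrite in_itv /= => /(dM c) [].
have tt : Num.min 0 t <= t <= Num.max 0 t.
  by rewrite ge_min le_max !lexx !orbT.
have [_ Nt _] := NP t tt.
apply/eqP; rewrite eq_le Nt andbT.
have Mle c : N t * expR (c * t) <= 0 -> N t <= 0.
  by rewrite pmulr_lle0 // expR_gt0.
have [t0|t0] := leP 0 t.
  apply: (Mle (- L)).
  have [s st|E|s] := @MVT_segment R (fun s => N s * expR (- L * s))
      (fun s => (dN s + - L * N s) * expR (- L * s)) 0 t t0.
  - apply: dM; rewrite min_l // max_r //.
    by move: st; rewrite in_itv /= => /andP[/ltW -> /ltW ->].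
  - by have := cM (- L); rewrite min_l // max_r.
  rewrite in_itv /= => st; rewrite N0 mul0r !subr0 => ->.
  rewrite mulr_le0_ge0 // mulr_le0_ge0 ?expR_ge0 //.
  have [|_ _] := NP s; first by rewrite min_l // max_r.
  by rewrite ler_norml => /andP[_]; rewrite mulNr subr_le0.
apply: (Mle L).
have [s st|E|s] := @MVT_segment R (fun s => N s * expR (L * s))
    (fun s => (dN s + L * N s) * expR (L * s)) t 0 (ltW t0).
- apply: dM; rewrite min_r ?max_l ?(ltW t0) //.
  by move: st; rewrite in_itv /= => /andP[/ltW -> /ltW ->].
- by have := cM L; rewrite min_r ?max_l ?(ltW t0).
rewrite in_itv /= => st; rewrite N0 mul0r !sub0r => E.
rewrite -oppr_ge0 E mulr_ge0 ?oppr_ge0 ?(ltW t0) // mulr_ge0 ?expR_ge0 //.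
have [|_ _] := NP s; first by rewrite min_r ?max_l ?(ltW t0).
by rewrite ler_norml => /andP[+ _]; rewrite -subr_ge0 opprK.
Qed.

End Gronwall.

Section Uniqueness.
Variables (R : realType) (n : nat) (U : set 'rV[R]_n).
Hypothesis oU : open U.
Implicit Types (f : 'rV[R]_n -> R).

(** The energy [N], the sum of the squares of the 1-jet, satisfies a Gronwall inequality along every
    axis-parallel segment, so its vanishing spreads over the box. *)
Lemma second_order_uniqueness f x r K : smooth_on U f -> box x r `<=` U ->
  (forall y i j, box x r y -> `|partial i (partial j f) y| <=
     K * (`|f y| + \sum_k `|partial k f y|)) ->
  forall y z, box x r y -> box x r z ->
    f y = 0 -> (forall k, partial k f y = 0) ->
    f z = 0 /\ forall k, partial k f z = 0.
Proof.
move=> sf bU HK y z yx zx fy dfy.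
pose N z := f z * f z + \sum_k partial k f z * partial k f z.
have fN w : f w ^+ 2 <= N w.
  by rewrite expr2 lerDl; apply: sumr_ge0 => k _; rewrite -expr2 sqr_ge0.
have dN w k : partial k f w ^+ 2 <= N w.
  rewrite /N (bigD1 k) //= -!expr2 addrCA lerDl addr_ge0 ?sqr_ge0 //.
  by apply: sumr_ge0 => j _; rewrite -expr2 sqr_ge0.
have N0 w : 0 <= N w by apply: le_trans (fN w); exact: sqr_ge0.
have prod_le w (a b : R) : a ^+ 2 <= N w -> b ^+ 2 <= N w -> `|a| * `|b| <= N w.
  rewrite -(real_normK (num_real a)) -(real_normK (num_real b)).
  move: (N w) (`|a|) (`|b|) => M p q pM qM; have := sqr_ge0 (p - q); nra.
suff Nz : N z = 0.
  split=> [|k]; apply/eqP; rewrite -sqrf_eq0 eq_le sqr_ge0 -Nz andbT.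
    exact: fN.
  exact: dN.
apply: (box_ind (P := [set w | N w = 0])) yx zx _ => /=; last first.
  rewrite /N fy mul0r add0r big1 // => k _.
  by rewrite dfy mul0r.
move=> {fy dfy y z} y i t yx tyx Ny.
(* Any product of two entries of the 1-jet is at most [N] in absolute value. The term [2 f f_i] thus
   contributes 2; each [2 f_k f_ik], by the hypothesis on second derivatives, contributes [2 |K|]
   times [1 + n] such products. The sign of [K] is unknown, hence the absolute value. *)
pose L := 2 + \sum_(k < n) 2 * `|K| * (1 + n%:R).
pose d w := 2 * f w * partial i f w +
  \sum_k 2 * partial k f w * partial i (partial k f) w.
apply: (@gronwall0 R (fun s => N (s *: delta_mx 0 i + y))
  (fun s => d (s *: delta_mx 0 i + y)) L t); last by rewrite scale0r add0r.
move=> s st.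
have bs := box_axis yx tyx st.
have Us := bU _ bs.
split => //.
  have sN : smooth_on U N.
    apply: smoothD => //; first exact: smoothM.
    by apply: smooth_sum => // k; apply: smoothM => //; exact: smooth_partial.
  apply: is_derive_eq; first exact: (line_is_derive sN Us).
  rewrite /N (partialD (U := U)) //; last 2 first.
  - exact: smoothM.
  - by apply: smooth_sum => // k; apply: smoothM => //; exact: smooth_partial.
  rewrite (partial_sum oU) //; last first.
    by move=> k; apply: smoothM => //; exact: smooth_partial.
  rewrite (partialM (U := U)) // /d; congr (_ + _); first by ring.
  apply: eq_bigr => k _; rewrite (partialM (U := U)) //; try exact: smooth_partial.
  by ring.
set w := _ + y in bs Us *.
rewrite /L [leRHS]mulrDl /=; apply: le_trans (ler_normD _ _) _; apply: lerD.
  by rewrite -mulrA normrM ger0_norm // ler_wpM2l // normrM prod_le.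
rewrite mulr_suml; apply: le_trans (ler_norm_sum _ _ _) _.
apply: ler_sum => k _; rewrite -!mulrA normrM ger0_norm // ler_wpM2l //.
rewrite normrM; apply: le_trans (_ : `|partial k f w| *
   (`|K| * (`|f w| + \sum_k `|partial k f w|)) <= _).
  rewrite ler_wpM2l //; apply: le_trans (HK _ _ _ bs) _.
  by rewrite ler_wpM2r ?ler_norm // addr_ge0 // sumr_ge0.
rewrite mulrCA ler_wpM2l // mulrDl mul1r mulrDr.
apply: lerD; first exact: prod_le.
rewrite mulr_sumr mulr_natl -[X in _ *+ X]card_ord -sumr_const.
by apply: ler_sum => j _; exact: prod_le.
Qed.

End Uniqueness.

(** * Pointwise algebra of the static equation *)

Section PointwiseAlgebra.
Variables (R : realFieldType) (n : nat).
Implicit Types (u v w q : 'rV[R]_n) (G H P : 'M[R]_n).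

(** Rows hold covector components. With [H] the inverse metric, this is the inner product of
    covectors, [u *m H] raises the index, and [u *m H *m P] is the contraction of Ricci with [u]. *)
Definition dot H u v : R := (u *m H *m v^T) 0 0.

Lemma dotE H u v : u *m H *m v^T = (dot H u v)%:M.
Proof. by rewrite [LHS]mx11_scalar. Qed.

Lemma dotC H u v : H^T = H -> dot H u v = dot H v u.
Proof.
move=> Hs; have -> : dot H v u = (u *m H *m v^T)^T 0 0.
  by rewrite !trmx_mul trmxK Hs mulmxA.
by rewrite mxE.
Qed.

Lemma dotDl H u v w : dot H (u + v) w = dot H u w + dot H v w.
Proof. by rewrite /dot !mulmxDl mxE. Qed.

Lemma dotZl H a u v : dot H (a *: u) v = a * dot H u v.
Proof. by rewrite /dot -!scalemxAl mxE. Qed.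

Lemma dotZr H a u v : dot H u (a *: v) = a * dot H u v.
Proof. by rewrite /dot linearZ /= -scalemxAr mxE. Qed.

(* The algebraic identity that the Ricci identity leaves at a zero of a static
   potential with differential [u], the curvature being expressed by Ricci. *)
Definition static_alg G H P u := forall i j k : 'I_n,
  2 * (u 0 i * P j k - u 0 j * P i k)
  + (u *m H *m P) 0 i * G j k - (u *m H *m P) 0 j * G i k = 0.

Lemma static_alg_ricci G H P u : H *m G = 1%:M -> H^T = H -> P^T = P -> G^T = G ->
  static_alg G H P u ->
  let N := dot H u u in let s := dot H (u *m H *m P) u in
  N *: (u *m H *m P) = s *: u /\
  (2 * N ^+ 2) *: P = s *: (3 *: (u^T *m u) - N *: G).
Proof.
move=> HG Hs Ps Gs T N s; set q := u *m H *m P.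
have Tj j : 2 *: (u^T *m row j P - u 0 j *: P) + q^T *m row j G - q 0 j *: G = 0.
  apply/matrixP => i k; have := T i j k; rewrite -/q; move: (q) => p.
  rewrite !mxE !big_ord1 !mxE ![ord0]ord1.
  by move=> <-; ring.
have T1 : 2 *: (N *: P - u^T *m q) + s *: G - q^T *m u = 0.
  apply/matrixP => j k.
  have := congr1 (mulmx (u *m H)) (Tj j).
  rewrite mulmx0 mulmxBr mulmxDr -scalemxAr mulmxBr -!scalemxAr.
  rewrite ![u *m H *m (_ *m _)]mulmxA !dotE [dot H u q]dotC // -/N -/s !mul_scalar_mx.
  rewrite -[u *m H *m G]mulmxA HG mulmx1 -/q.
  move=> /(congr1 (fun M : 'rV[R]_n => M 0 k)).
  move: (q) => p; rewrite !mxE !big_ord1 !mxE ![ord0]ord1 => <-; ring.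
have T2 : 2 *: (N *: P - q^T *m u) + s *: G - u^T *m q = 0.
  apply/matrixP => j k; have := congr1 (fun M : 'M[R]_n => M k j) T1.
  have Pkj : P k j = P j k by rewrite -[in LHS]Ps mxE.
  have Gkj : G k j = G j k by rewrite -[in LHS]Gs mxE.
  by move: (q) => p; rewrite !mxE !big_ord1 !mxE Pkj Gkj => <-; ring.
have uq : u^T *m q = q^T *m u.
  apply/eqP; rewrite -subr_eq0; apply/eqP.
  have := congr2 (fun A B => A - B) T1 T2; rewrite subrr.
  move: (u^T *m q) (q^T *m u) (N *: P) (s *: G) => A B C D E.
  apply/matrixP => i j; have := congr1 (fun M : 'M[R]_n => M i j) E.
  by rewrite !mxE => e; lra.
have T3 : (2 * N) *: P = 3 *: (u^T *m q) - s *: G.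
  move: T1; rewrite -uq; move: (u^T *m q) => A E.
  apply/matrixP => i j; have := congr1 (fun M : 'M[R]_n => M i j) E.
  by rewrite !mxE => e; lra.
have Nq : N *: q = s *: u.
  have := congr1 (mulmx (u *m H)) T3.
  rewrite mulmxBr -!scalemxAr mulmxA !dotE -/q -/N mul_scalar_mx.
  rewrite -[u *m H *m G]mulmxA HG mulmx1 => E.
  apply/rowP => k; have := congr1 (fun M : 'rV[R]_n => M 0 k) E.
  by rewrite !mxE => e; lra.
split=> //.
apply/matrixP => i j.
have := congr1 (fun M : 'M[R]_n => M i j) T3.
have := congr1 (fun M : 'rV[R]_n => M 0 j) Nq.
move: (q) => p; rewrite !mxE !big_ord1 !mxE ![ord0]ord1 => e1 e2.
rewrite expr2; have -> : 2 * (N * N) * P i j = N * (2 * N * P i j) by ring.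
rewrite e2; have -> : N * (3 * (u 0 i * p 0 j) - s * G i j) =
   3 * u 0 i * (N * p 0 j) - N * s * G i j by ring.
by rewrite e1; ring.
Qed.

(** By [static_alg_ricci], [u] is an eigencovector of [P] of eigenvalue [s / N], and an
    eigencovector independent of [u] has eigenvalue [- s / (2 N)]. Since [v] is one, and the roles
    of [u] and [v] can be exchanged, each eigenvalue is minus half the other, so both vanish. *)
Lemma static_alg_indep G H P u v : H *m G = 1%:M -> H^T = H -> P^T = P ->
  G^T = G -> (forall w : 'rV_n, w != 0 -> 0 < dot H w w) ->
  static_alg G H P u -> static_alg G H P v ->
  (forall a b : R, a *: u + b *: v = 0 -> a = 0 /\ b = 0) -> P = 0.
Proof.
move=> HG Hs Ps Gs Hpos Tu Tv uv.
have main (u' v' : 'rV[R]_n) : static_alg G H P u' -> static_alg G H P v' ->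
    (forall a b : R, a *: u' + b *: v' = 0 -> a = 0 /\ b = 0) ->
    0 < dot H u' u' /\
    2 * dot H u' u' * dot H (v' *m H *m P) v' +
    dot H v' v' * dot H (u' *m H *m P) u' = 0.
  move=> Tu' Tv' uv'.
  have [_ Pu] := static_alg_ricci HG Hs Ps Gs Tu'.
  have [Nv _] := static_alg_ricci HG Hs Ps Gs Tv'.
  have u0 : u' != 0.
    apply/eqP => u0; have [] := uv' 1 0.
      by rewrite u0 scaler0 scale0r addr0.
    by move/eqP; rewrite oner_eq0.
  have Nu0 := Hpos _ u0; split=> //.
  move: Nv Pu; set N := dot H u' u'; set s := dot H _ u'.
  set N' := dot H v' v'; set s' := dot H _ v' => Nv Pu.
  have := congr1 (mulmx (v' *m H)) Pu.
  rewrite -!scalemxAr mulmxBr -!scalemxAr mulmxA dotE mul_scalar_mx.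
  rewrite -[v' *m H *m G]mulmxA HG mulmx1 => E.
  (* The relation comes from evaluating [N' (v' H P)] in two ways: as [s' v'], and by the formula
     for [P] attached to [u']. Independence kills the coefficient of [v']. *)
  have [|_ e] := uv' (- (3 * N' * s * dot H v' u')) (2 * N ^+ 2 * s' + N' * s * N).
    apply/rowP => k; move: (v' *m H *m P) Nv E => p Nv E.
    have := congr1 (fun M : 'rV[R]_n => M 0 k) E.
    have := congr1 (fun M : 'rV[R]_n => M 0 k) Nv.
    rewrite !mxE => e1 e2.
    have -> : - (3 * N' * s * dot H v' u') * u' 0 k +
        (2 * N ^+ 2 * s' + N' * s * N) * v' 0 k =
      2 * N ^+ 2 * (s' * v' 0 k)
      - N' * (s * (3 * (dot H v' u' * u' 0 k) - N * v' 0 k)) by ring.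
    by rewrite -e1 -e2; ring.
  apply: (mulIf (lt0r_neq0 Nu0)); rewrite mul0r -[RHS]e -/N; ring.
have [Nu e1] := main _ _ Tu Tv uv.
have [|Nv e2] := main _ _ Tv Tu.
  by move=> a b; rewrite addrC => /uv [].
have [_ Pu] := static_alg_ricci HG Hs Ps Gs Tu.
have s0 : dot H (u *m H *m P) u = 0.
  move: Nu Nv e1 e2; set N := dot H u u; set s := dot H _ u.
  set N' := dot H v v; set s' := dot H _ v => Nu Nv e1 e2.
  have : s * N' = 0 by lra.
  by move/eqP; rewrite mulf_eq0 (gt_eqF Nv) orbF => /eqP.
move: Pu; rewrite s0 scale0r => /eqP; rewrite scaler_eq0 => /orP[|/eqP //].
by rewrite mulf_eq0 pnatr_eq0 /= expf_eq0 /= (gt_eqF Nu).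
Qed.

End PointwiseAlgebra.

(** * Riemann curvature in terms of Ricci in dimension three *)

Section ThreeDimensionalCurvature.
Variable R : realFieldType.

Let i0 : 'I_3 := Ordinal (isT : (0 < 3)%N).
Let i1 : 'I_3 := Ordinal (isT : (1 < 3)%N).
Let i2 : 'I_3 := Ordinal (isT : (2 < 3)%N).

Lemma ord3P (Q : 'I_3 -> Prop) : Q i0 -> Q i1 -> Q i2 -> forall i, Q i.
Proof.
move=> q0 q1 q2 [[|[|[|//]]] lti].
- by have -> : Ordinal lti = i0 by exact: val_inj.
- by have -> : Ordinal lti = i1 by exact: val_inj.
- by have -> : Ordinal lti = i2 by exact: val_inj.
Qed.

Lemma sum3 (F : 'I_3 -> R) : \sum_i F i = F i0 + F i1 + F i2.
Proof.
rewrite !big_ord_recl big_ord0 addr0 addrA.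
by congr (F _ + F _ + F _); exact: val_inj.
Qed.

Lemma det3 (H : 'M[R]_3) : \det H =
  H i0 i0 * (H i1 i1 * H i2 i2 - H i1 i2 * H i2 i1)
  - H i0 i1 * (H i1 i0 * H i2 i2 - H i1 i2 * H i2 i0)
  + H i0 i2 * (H i1 i0 * H i2 i1 - H i1 i1 * H i2 i0).
Proof.
rewrite (expand_det_row _ i0) sum3 /cofactor.
have det2 (A : 'M[R]_2) : \det A =
    A ord0 ord0 * A ord_max ord_max - A ord0 ord_max * A ord_max ord0.
  rewrite (expand_det_row _ ord0) !big_ord_recl big_ord0 addr0 /cofactor.
  rewrite !det_mx11 !mxE /= expr0 expr1 mul1r mulN1r mulrN.
  by congr (_ * A _ _ - A _ _ * A _ _); exact: val_inj.
rewrite !det2 !mxE /= expr0 expr1 sqrrN expr1n.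
have E (i : 'I_3) (j : 'I_2) k : bump i j = nat_of_ord k -> lift i j = k.
  by move=> e; exact: val_inj.
rewrite (E i0 ord0 i1) // (E i0 ord_max i2) // (E i1 ord0 i0) // (E i1 ord_max i2) //
  (E i2 ord0 i0) // (E i2 ord_max i1) //.
ring.
Qed.

(* Writing [D] as [eps_lka eps_ijb d_ab], its trace [r] is the cofactor form
   polarised at [H], so that [2 det(H) d = tr(r H) H - 2 H r^T H]. *)
Lemma ricci_flat_curv3 (H : 'M[R]_3) (D : 'I_3 -> 'I_3 -> 'I_3 -> 'I_3 -> R) :
  H^T = H -> \det H != 0 ->
  (forall l k i j, D l k i j = - D k l i j) ->
  (forall l k i j, D l k i j = - D l k j i) ->
  (forall k j, \sum_i \sum_l H i l * D l k i j = 0) ->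
  forall l k i j, D l k i j = 0.
Proof.
move=> Hs detH A1 A2 tr0.
have H10 : H i1 i0 = H i0 i1 by rewrite -[in LHS]Hs mxE.
have H20 : H i2 i0 = H i0 i2 by rewrite -[in LHS]Hs mxE.
have H21 : H i2 i1 = H i1 i2 by rewrite -[in LHS]Hs mxE.
have Z1 l i j : D l l i j = 0 by have := A1 l l i j; lra.
have Z2 l k i : D l k i i = 0 by have := A2 l k i i; lra.
pose a1 := A1 i1 i0; pose a2 := A1 i2 i1; pose a3 := A1 i0 i2.
have b1 l k := A2 l k i1 i0; have b2 l k := A2 l k i2 i1.
have b3 l k := A2 l k i0 i2.
have r k j := tr0 k j.
move: detH; rewrite det3 H10 H20 H21.
have := (r i0 i0, r i0 i1, r i0 i2, (r i1 i0, r i1 i1, r i1 i2),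
         (r i2 i0, r i2 i1, r i2 i2)).
rewrite !sum3 !(a1, a2, a3) !(b1, b2, b3) !(Z1, Z2) H10 H20 H21.
move: (H i0 i0) (H i0 i1) (H i0 i2) (H i1 i1) (H i1 i2) (H i2 i2).
move=> h00 h01 h02 h11 h12 h22 rs dH.
suff K : [/\ [/\ D i1 i2 i1 i2 = 0, D i1 i2 i2 i0 = 0 & D i1 i2 i0 i1 = 0],
   [/\ D i2 i0 i1 i2 = 0, D i2 i0 i2 i0 = 0 & D i2 i0 i0 i1 = 0] &
   [/\ D i0 i1 i1 i2 = 0, D i0 i1 i2 i0 = 0 & D i0 i1 i0 i1 = 0]].
  case: K => -[k1 k2 k3] [k4 k5 k6] [k7 k8 k9].
  have K := (k1, k2, k3, (k4, k5, k6), (k7, k8, k9)).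
  apply: ord3P; apply: ord3P; apply: ord3P; apply: ord3P;
    rewrite ?(a1, a2, a3) ?(b1, b2, b3) ?(Z1, Z2) ?K ?oppr0 //.
move: rs.
move: (D i1 i2 i1 i2) (D i1 i2 i2 i0) (D i1 i2 i0 i1) => d00 d01 d02.
move: (D i2 i0 i1 i2) (D i2 i0 i2 i0) (D i2 i0 i0 i1) => d10 d11 d12.
move: (D i0 i1 i1 i2) (D i0 i1 i2 i0) (D i0 i1 i0 i1) => d20 d21 d22.
move=> [[[[r00 r01] r02] [[r10 r11] r12]] [[r20 r21] r22]].
move: r00; set e00 := (X in X = 0) => r00.
move: r01; set e01 := (X in X = 0) => r01.
move: r02; set e02 := (X in X = 0) => r02.
move: r10; set e10 := (X in X = 0) => r10.
move: r11; set e11 := (X in X = 0) => r11.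
move: r12; set e12 := (X in X = 0) => r12.
move: r20; set e20 := (X in X = 0) => r20.
move: r21; set e21 := (X in X = 0) => r21.
move: r22; set e22 := (X in X = 0) => r22.
pose t := e00 * h00 + e11 * h11 + e22 * h22 + (e01 + e10) * h01
  + (e02 + e20) * h02 + (e12 + e21) * h12.
pose comb (x a0 a1 a2 b0 b1 b2 : R) := t * x -
  2 * (a0 * (e00 * b0 + e10 * b1 + e20 * b2) + a1 * (e01 * b0 + e11 * b1 + e21 * b2)
       + a2 * (e02 * b0 + e12 * b1 + e22 * b2)).
have comb0 x a0 a1' a2' b0 b1' b2' : comb x a0 a1' a2' b0 b1' b2' = 0.
  rewrite /comb /t r00 r01 r02 r10 r11 r12 r20 r21 r22; ring.
have two0 : 2 != 0 :> R by rewrite pnatr_eq0.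
have dH2 := mulf_neq0 two0 dH.
split; split; apply: (mulfI dH2); rewrite mulr0.
- by rewrite -(comb0 h00 h00 h01 h02 h00 h01 h02) /comb /t /e00 /e01 /e02 /e10 /e11 /e12 /e20 /e21 /e22; ring.
- by rewrite -(comb0 h01 h00 h01 h02 h01 h11 h12) /comb /t /e00 /e01 /e02 /e10 /e11 /e12 /e20 /e21 /e22; ring.
- by rewrite -(comb0 h02 h00 h01 h02 h02 h12 h22) /comb /t /e00 /e01 /e02 /e10 /e11 /e12 /e20 /e21 /e22; ring.
- by rewrite -(comb0 h01 h01 h11 h12 h00 h01 h02) /comb /t /e00 /e01 /e02 /e10 /e11 /e12 /e20 /e21 /e22; ring.
- by rewrite -(comb0 h11 h01 h11 h12 h01 h11 h12) /comb /t /e00 /e01 /e02 /e10 /e11 /e12 /e20 /e21 /e22; ring.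
- by rewrite -(comb0 h12 h01 h11 h12 h02 h12 h22) /comb /t /e00 /e01 /e02 /e10 /e11 /e12 /e20 /e21 /e22; ring.
- by rewrite -(comb0 h02 h02 h12 h22 h00 h01 h02) /comb /t /e00 /e01 /e02 /e10 /e11 /e12 /e20 /e21 /e22; ring.
- by rewrite -(comb0 h12 h02 h12 h22 h01 h11 h12) /comb /t /e00 /e01 /e02 /e10 /e11 /e12 /e20 /e21 /e22; ring.
- by rewrite -(comb0 h22 h02 h12 h22 h02 h12 h22) /comb /t /e00 /e01 /e02 /e10 /e11 /e12 /e20 /e21 /e22; ring.
Qed.

(** Vanishing of the Weyl tensor in dimension three. The difference [D] of the two sides keeps the
    two antisymmetries. The right-hand side has Ricci trace [3 P + (tr P) G - P - P], which is [P]
    as [tr P = 0], so [D] is trace-free and [ricci_flat_curv3] applies. *)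
Lemma curv3_ricci (G H P : 'M[R]_3) (Om : 'I_3 -> 'I_3 -> 'M[R]_3) :
  H *m G = 1%:M -> H^T = H -> G^T = G -> P^T = P ->
  (forall i j, (G *m Om i j)^T = - (G *m Om i j)) ->
  (forall i j, Om i j = - Om j i) ->
  (forall j k, P j k = \sum_i Om i j i k) ->
  \sum_j \sum_k H j k * P j k = 0 ->
  forall l k i j, (G *m Om i j) l k =
    G l i * P k j + P l i * G k j - G l j * P k i - P l j * G k i.
Proof.
move=> HG Hs Gs Ps A1 A2 PE trP l k i j.
pose D (l k i j : 'I_3) : R := (G *m Om i j) l k -
  (G l i * P k j + P l i * G k j - G l j * P k i - P l j * G k i).
have Gsw a b : G a b = G b a by rewrite -[in LHS]Gs mxE.
have Hsw a b : H a b = H b a by rewrite -[in LHS]Hs mxE.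
have Psw a b : P a b = P b a by rewrite -[in LHS]Ps mxE.
apply/eqP; rewrite -subr_eq0 -/(D l k i j); apply/eqP.
apply: (@ricci_flat_curv3 H) => // {l k i j}.
- apply/eqP => detH; have := congr1 determinant HG.
  by rewrite det_mulmx detH mul0r det1 => /eqP; rewrite eq_sym oner_eq0.
- move=> l k i j; have := congr1 (fun M : 'M[R]_3 => M k l) (A1 i j).
  rewrite /D !mxE => ->.
  by rewrite (Gsw k i) (Gsw k j) (Gsw l i) (Gsw l j); ring.
- move=> l k i j; rewrite /D [in LHS]A2 mulmxN mxE; ring.
move=> k j; rewrite /D.
under eq_bigr => i _.
  under eq_bigr => l _ do rewrite mulrBr.
  rewrite sumrB.
  over.
rewrite sumrB.
have -> : \sum_i \sum_l H i l * (G *m Om i j) l k = P k j.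
  rewrite Psw PE; apply: eq_bigr => i _.
  by rewrite -[Om i j in RHS]mul1mx -HG -mulmxA [RHS]mxE.
have HG1 a b : \sum_l H a l * G l b = (a == b)%:R.
  by have := congr1 (fun M : 'M[R]_3 => M a b) HG; rewrite !mxE.
have -> : \sum_i \sum_l H i l * (G l i * P k j + P l i * G k j - G l j * P k i
    - P l j * G k i) =
  \sum_i (\sum_l H i l * G l i) * P k j + (\sum_i \sum_l H i l * P i l) * G k j
  - \sum_i (\sum_l H i l * G l j) * P k i - \sum_l (\sum_i H l i * G i k) * P l j.
  have -> : \sum_l (\sum_i H l i * G i k) * P l j =
      \sum_i \sum_l H i l * (P l j * G k i).
    rewrite exchange_big /=; apply: eq_bigr => a _; rewrite mulr_suml.
    apply: eq_bigr => b _; rewrite (Gsw b k).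
    by rewrite (Hsw a b); ring.
  rewrite mulr_suml -big_split /= -!sumrB; apply: eq_bigr => a _.
  rewrite !mulr_suml -big_split /= -!sumrB; apply: eq_bigr => b _.
  by rewrite (Psw a b); ring.
rewrite trP mul0r addr0.
under eq_bigr => i _ do rewrite HG1 eqxx mul1r.
under [X in _ - (_ - X - _)]eq_bigr => i _ do rewrite HG1.
under [X in _ - (_ - _ - X)]eq_bigr => i _ do rewrite HG1.
rewrite sumr_const card_ord (bigD1 j) //= eqxx big1; last first.
  by move=> i /negPf ->; rewrite mul0r.
rewrite (bigD1 k) //= eqxx big1; last by move=> i /negPf ->; rewrite mul0r.
rewrite !mul1r !addr0; ring.
Qed.

End ThreeDimensionalCurvature.

(** * The Ricci identity of a static potential and its traces *)

Section StaticIdentity.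
Variables (R : realFieldType) (n : nat).
Implicit Types (u v w q : 'rV[R]_n) (G H P : 'M[R]_n).

(** The factor 2 collects two equal contributions: one from the derivative of [f Ric], one from the
    curvature once it is expressed through Ricci. *)
Lemma static_identity G H P (Om : 'I_n -> 'I_n -> 'M[R]_n) u (f : R)
    (C : 'I_n -> 'I_n -> 'I_n -> R) :
  H *m G = 1%:M -> G^T = G -> P^T = P ->
  (forall l k i j, (G *m Om i j) l k =
    G l i * P k j + P l i * G k j - G l j * P k i - P l j * G k i) ->
  (forall i j k, u 0 i * P j k - u 0 j * P i k + f * C i j k
     = - (u *m Om i j) 0 k) ->
  forall i j k, 2 * (u 0 i * P j k - u 0 j * P i k)
    + (u *m H *m P) 0 i * G j k - (u *m H *m P) 0 j * G i k + f * C i j k = 0.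
Proof.
move=> HG Gs Ps GOm RI i j k.
have Gsw a b : G a b = G b a by rewrite -[in LHS]Gs mxE.
have Psw a b : P a b = P b a by rewrite -[in LHS]Ps mxE.
have uOm : (u *m Om i j) 0 k = u 0 i * P j k + (u *m H *m P) 0 i * G j k
    - u 0 j * P i k - (u *m H *m P) 0 j * G i k.
  have -> : u *m Om i j = (u *m H) *m (G *m Om i j).
    by rewrite mulmxA -[u *m H *m G]mulmxA HG mulmx1.
  have uE a : u 0 a = \sum_l (u *m H) 0 l * G l a.
    by rewrite -[LHS](congr1 (fun M : 'rV[R]_n => M 0 a) (mulmx1 u)) -HG mulmxA mxE.
  rewrite (uE i) (uE j) [LHS]mxE [(_ *m P) 0 i]mxE [(_ *m P) 0 j]mxE.
  rewrite !mulr_suml -big_split /= -!sumrB; apply: eq_bigr => l _.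
  by rewrite GOm (Psw k j) (Psw k i) (Gsw k j) (Gsw k i); ring.
have := RI i j k; rewrite uOm => e; lra.
Qed.

(** Tracing over [j] and [k], the terms in [q = u *m H *m P] come with coefficients [-2], [+3] and
    [-1]; they cancel precisely because the dimension is three. What remains is [f] times the
    divergence, so the second Bianchi identity is bypassed. *)
Lemma static_div G H P u (f : R) (dP : 'I_n -> 'I_n -> 'I_n -> R) :
  n = 3 -> H *m G = 1%:M -> H^T = H -> G^T = G -> P^T = P ->
  \sum_j \sum_k H j k * P j k = 0 ->
  (forall i, \sum_j \sum_k H j k * dP i j k = 0) ->
  (forall i j k, 2 * (u 0 i * P j k - u 0 j * P i k)
    + (u *m H *m P) 0 i * G j k - (u *m H *m P) 0 j * G i k
    + f * (dP i j k - dP j i k) = 0) ->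
  forall i, f * (\sum_j \sum_k H j k * dP j i k) = 0.
Proof.
move=> n3 HG Hs Gs Ps trP trdP T i.
have Gsw a b : G a b = G b a by rewrite -[in LHS]Gs mxE.
have Hsw a b : H a b = H b a by rewrite -[in LHS]Hs mxE.
have Psw a b : P a b = P b a by rewrite -[in LHS]Ps mxE.
have HG1 a b : \sum_l H a l * G l b = (a == b)%:R.
  by have := congr1 (fun M : 'M[R]_n => M a b) HG; rewrite !mxE.
set q := u *m H *m P in T.
have e1 : \sum_j \sum_k H j k * (u 0 j * P i k) = q 0 i.
  rewrite exchange_big /q [RHS]mxE /=; apply: eq_bigr => k _.
  rewrite [(u *m H) 0 k]mxE mulr_suml; apply: eq_bigr => j _.
  by rewrite (Psw i k); ring.
have e2 : \sum_j \sum_k H j k * G j k = 3.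
  under eq_bigr => j _ do under eq_bigr => k _ do rewrite (Gsw j k).
  under eq_bigr => j _ do rewrite HG1 eqxx.
  by rewrite sumr_const card_ord n3.
have e3 : \sum_j \sum_k H j k * (q 0 j * G i k) = q 0 i.
  transitivity (\sum_j q 0 j * (\sum_k H j k * G k i)).
    apply: eq_bigr => j _; rewrite mulr_sumr; apply: eq_bigr => k _.
    by rewrite (Gsw i k); ring.
  rewrite (bigD1 i) //= HG1 eqxx mulr1 big1 ?addr0 // => j /negPf ji.
  by rewrite HG1 ji mulr0.
have : \sum_j \sum_k H j k * (2 * (u 0 i * P j k - u 0 j * P i k)
    + q 0 i * G j k - q 0 j * G i k + f * (dP i j k - dP j i k)) = 0.
  by apply: big1 => j _; apply: big1 => k _; rewrite T mulr0.
have -> : \sum_j \sum_k H j k * (2 * (u 0 i * P j k - u 0 j * P i k)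
    + q 0 i * G j k - q 0 j * G i k + f * (dP i j k - dP j i k)) =
  2 * u 0 i * (\sum_j \sum_k H j k * P j k)
  - 2 * (\sum_j \sum_k H j k * (u 0 j * P i k))
  + q 0 i * (\sum_j \sum_k H j k * G j k)
  - (\sum_j \sum_k H j k * (q 0 j * G i k))
  + f * (\sum_j \sum_k H j k * dP i j k) - f * (\sum_j \sum_k H j k * dP j i k).
  rewrite !mulr_sumr -!(sumrB, big_split) /=; apply: eq_bigr => j _.
  rewrite !mulr_sumr -!(sumrB, big_split) /=; apply: eq_bigr => k _.
  ring.
rewrite trP trdP e1 e2 e3 => e; lra.
Qed.

(* [A] stands for the covariant derivative of the Killing field [w], [W1] and
   [S1] for the differentials of [dot w w] and of [P(w, w)]. *)
Lemma killing_ricci_gradient G H P (dP : 'I_n -> 'M[R]_n) w (A : 'M[R]_n)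
    (W1 S1 : 'rV[R]_n) (S : R) :
  let W := dot H w w in
  W != 0 -> H *m G = 1%:M -> H^T = H -> G^T = G -> P^T = P -> A^T = - A ->
  W1 = 2 *: (w *m H *m A^T) ->
  (2 * W ^+ 2) *: P = S *: (3 *: (w^T *m w) - W *: G) ->
  (forall m j k, 4 * W * W1 0 m * P j k + 2 * W ^+ 2 * dP m j k =
     S1 0 m * (3 * w 0 j * w 0 k - W * G j k)
     + S * (3 * (A m j * w 0 k + w 0 j * A m k) - W1 0 m * G j k)) ->
  (forall k, \sum_m \sum_j H m j * dP m k j = 0) ->
  (forall m, (dP m)^T = dP m) ->
  forall k, 2 * W * S1 0 k + S * W1 0 k = 0.
Proof.
move=> W W0 HG Hs Gs Ps As W1E PE dE div dPs.
have Gsw a b : G a b = G b a by rewrite -[in LHS]Gs mxE.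
have Hsw a b : H a b = H b a by rewrite -[in LHS]Hs mxE.
have Psw a b : P a b = P b a by rewrite -[in LHS]Ps mxE.
have Asw a b : A a b = - A b a.
  by have := congr1 (fun M : 'M[R]_n => M b a) As; rewrite !mxE.
have dPsw m a b : dP m a b = dP m b a by rewrite -[in LHS]dPs mxE.
have HG1 a b : \sum_l H a l * G l b = (a == b)%:R.
  by have := congr1 (fun M : 'M[R]_n => M a b) HG; rewrite !mxE.
have W1A : W1 = - (2 *: (w *m H *m A)).
  by rewrite W1E As mulmxN scalerN.
have W1w : dot H W1 w = 0.
  rewrite W1E dotZl; set p := w *m H.
  have pT : p^T = H *m w^T by rewrite trmx_mul Hs.
  have -> : dot H (p *m A^T) w = (p *m A^T *m p^T) 0 0 by rewrite /dot pT mulmxA.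
  have : (p *m A^T *m p^T) 0 0 = - (p *m A^T *m p^T) 0 0.
    have E : (p *m A^T *m p^T)^T = - (p *m A^T *m p^T).
      by rewrite !trmx_mul !trmxK [in RHS]As mulmxN mulNmx opprK mulmxA.
    by have := congr1 (fun M : 'M[R]_1 => M 0 0) E; rewrite mxE [RHS]mxE.
  lra.
have trE (F1 F2 : 'rV[R]_n) : \sum_m \sum_j H m j * (F1 0 m * F2 0 j) = dot H F1 F2.
  rewrite /dot mxE exchange_big /=; apply: eq_bigr => j _.
  rewrite !mxE mulr_suml; apply: eq_bigr => m _; ring.
(* Contract the differentiated formula over [m] and [j]. The divergence drops out, the trace of [A]
   vanishes by antisymmetry, [w] contracted with [A] is [- W1 / 2], and [W1], being orthogonal to
   [w], is an eigencovector of [P] of eigenvalue [- S / (2 W)]. *)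
have SW1 k : W * S1 0 k = 3 * (dot H S1 w * w 0 k) - S * (1 / 2 * W1 0 k).
  have e1 : \sum_m \sum_j H m j * (W1 0 m * P j k) = (W1 *m H *m P) 0 k.
    rewrite exchange_big [RHS]mxE /=; apply: eq_bigr => j _.
    rewrite [(W1 *m H) 0 j]mxE mulr_suml; apply: eq_bigr => m _; ring.
  have e2 : \sum_m \sum_j H m j * dP m j k = 0.
    rewrite -[RHS](div k); apply: eq_bigr => m _; apply: eq_bigr => j _.
    by rewrite dPsw.
  have e3 (F : 'rV[R]_n) : \sum_m \sum_j H m j * (F 0 m * G j k) = F 0 k.
    transitivity (\sum_m F 0 m * (\sum_j H m j * G j k)).
      apply: eq_bigr => m _; rewrite mulr_sumr; apply: eq_bigr => j _; ring.
    rewrite (bigD1 k) //= HG1 eqxx mulr1 big1 ?addr0 // => j /negPf ji.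
    by rewrite HG1 ji mulr0.
  have e4 : \sum_m \sum_j H m j * A m j = 0.
    have : \sum_m \sum_j H m j * A m j = - (\sum_m \sum_j H m j * A m j).
      rewrite [in LHS]exchange_big -sumrN; apply: eq_bigr => m _.
      rewrite -sumrN; apply: eq_bigr => j _; by rewrite (Hsw j m) (Asw j m); ring.
    lra.
  have e5 : 2 * (\sum_m \sum_j H m j * (w 0 j * A m k)) = - W1 0 k.
    rewrite W1A !mxE opprK; congr (2 * _); apply: eq_bigr => m _.
    rewrite mxE mulr_suml; apply: eq_bigr => j _; rewrite (Hsw j m); ring.
  have W1P : 2 * W ^+ 2 * (W1 *m H *m P) 0 k = - (S * W * W1 0 k).
    have := congr1 (fun M => (W1 *m H *m M) 0 k) PE.
    rewrite -!scalemxAr mulmxBr -!scalemxAr mulmxA dotE W1w mul_scalar_mx scale0r.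
    rewrite -[W1 *m H *m G]mulmxA HG mulmx1 !mxE => ->; ring.
  have e6 : \sum_m \sum_j H m j * (S1 0 m * w 0 j * w 0 k) = dot H S1 w * w 0 k.
    rewrite -trE mulr_suml; apply: eq_bigr => m _; rewrite mulr_suml.
    by apply: eq_bigr => j _; ring.
  have main : 4 * W * (W1 *m H *m P) 0 k =
      3 * (dot H S1 w * w 0 k) - W * S1 0 k - S * (3 / 2 * W1 0 k + W1 0 k).
    have : \sum_m \sum_j H m j *
        (4 * W * W1 0 m * P j k + 2 * W ^+ 2 * dP m j k) =
      \sum_m \sum_j H m j * (S1 0 m * (3 * w 0 j * w 0 k - W * G j k)
       + S * (3 * (A m j * w 0 k + w 0 j * A m k) - W1 0 m * G j k)).
      by apply: eq_bigr => m _; apply: eq_bigr => j _; rewrite dE.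
    have -> : \sum_m \sum_j H m j *
        (4 * W * W1 0 m * P j k + 2 * W ^+ 2 * dP m j k) =
       4 * W * (\sum_m \sum_j H m j * (W1 0 m * P j k)) +
       2 * W ^+ 2 * (\sum_m \sum_j H m j * dP m j k).
      rewrite !mulr_sumr -!(sumrB, big_split) /=; apply: eq_bigr => j _.
      rewrite !mulr_sumr -!(sumrB, big_split) /=; apply: eq_bigr => l _; ring.
    have -> : \sum_m \sum_j H m j * (S1 0 m * (3 * w 0 j * w 0 k - W * G j k)
       + S * (3 * (A m j * w 0 k + w 0 j * A m k) - W1 0 m * G j k)) =
       3 * (\sum_m \sum_j H m j * (S1 0 m * w 0 j * w 0 k))
       - W * (\sum_m \sum_j H m j * (S1 0 m * G j k))
       + 3 * S * w 0 k * (\sum_m \sum_j H m j * A m j)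
       + 3 * S * (\sum_m \sum_j H m j * (w 0 j * A m k))
       - S * (\sum_m \sum_j H m j * (W1 0 m * G j k)).
      rewrite !mulr_sumr -!(sumrB, big_split) /=; apply: eq_bigr => j _.
      rewrite !mulr_sumr -!(sumrB, big_split) /=; apply: eq_bigr => l _; ring.
    rewrite e1 e2 !e3 e4 e6 => e.
    move: e5; set Y := \sum_m \sum_j H m j * (w 0 j * A m k) in e * => e5.
    have -> : W1 0 k = - (2 * Y) by rewrite e5 opprK.
    rewrite mulr0 addr0 in e; rewrite e (_ : W1 0 k = - (2 * Y)); last by rewrite e5 opprK.
    by field.
  have : 4 * W * (W1 *m H *m P) 0 k = - (2 * S * W1 0 k).
    apply: (mulfI W0); have := W1P; rewrite expr2 => e; lra.
  by rewrite main => e; lra.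
(* Pairing [SW1] with [w] gives [W (S1, w) = 3 W (S1, w)]. *)
have Sw : dot H S1 w = 0.
  have E : W *: S1 = (3 * dot H S1 w) *: w + (- (S / 2)) *: W1.
    by apply/rowP => k; rewrite !mxE SW1; ring.
  have := congr1 (fun v => dot H v w) E.
  rewrite dotDl !dotZl W1w mulr0 addr0 -/W => e.
  apply: (mulfI W0); rewrite mulr0; lra.
move=> k; have := SW1 k; rewrite Sw => e.
by rewrite -mulrA e; field.
Qed.

End StaticIdentity.

(** * Matrix-valued functions *)

Section MatrixCalculus.
Variables (R : realType) (n : nat) (U : set 'rV[R]_n).
Hypothesis oU : open U.
Implicit Types (x : 'rV[R]_n) (i j k : 'I_n).

Definition mpartial k p q (A : 'rV[R]_n -> 'M[R]_(p, q)) : 'rV[R]_n -> 'M[R]_(p, q) :=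
  fun x => \matrix_(a, b) partial k (fun y => A y a b) x.

Definition msmooth p q (A : 'rV[R]_n -> 'M[R]_(p, q)) :=
  forall a b, smooth_on U (fun x => A x a b).

Section Rules.
Variables (p q r : nat).
Implicit Types (A B : 'rV[R]_n -> 'M[R]_(p, q)) (C : 'rV[R]_n -> 'M[R]_(q, r)).

Lemma mpartial_ext A B k x : (forall y, U y -> A y = B y) -> U x ->
  mpartial k A x = mpartial k B x.
Proof.
move=> AB Ux; apply/matrixP => a b; rewrite !mxE.
by apply: (partial_ext oU) => // y /AB ->.
Qed.

Lemma msmooth_partial A k : msmooth A -> msmooth (mpartial k A).
Proof.
move=> sA a b; apply: (smooth_ext oU) (smooth_partial k (sA a b)) => x _.
by rewrite mxE.
Qed.

Lemma msmooth_mul A C : msmooth A -> msmooth C -> msmooth (fun x => A x *m C x).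
Proof.
move=> sA sC a b.
have sAC c : smooth_on U (fun x => A x a c * C x c b) by exact: smoothM.
apply: (smooth_ext oU) (smooth_sum oU (index_enum 'I_q) xpredT sAC) => x _.
by rewrite mxE.
Qed.

Lemma msmooth_add A B : msmooth A -> msmooth B -> msmooth (fun x => A x + B x).
Proof.
move=> sA sB a b; apply: (smooth_ext oU) (smoothD oU (sA a b) (sB a b)) => x _.
by rewrite mxE.
Qed.

Lemma msmooth_scale (f : 'rV[R]_n -> R) A : smooth_on U f -> msmooth A ->
  msmooth (fun x => f x *: A x).
Proof.
move=> sf sA a b; apply: (smooth_ext oU) (smoothM oU sf (sA a b)) => x _.
by rewrite mxE.
Qed.

Lemma msmooth_sub A B : msmooth A -> msmooth B -> msmooth (fun x => A x - B x).
Proof.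
move=> sA sB a b; apply: (smooth_ext oU) (smoothB oU (sA a b) (sB a b)) => x _.
by rewrite !mxE.
Qed.

Lemma msmooth_tr A : msmooth A -> msmooth (fun x => (A x)^T).
Proof.
by move=> sA a b; apply: (smooth_ext oU) (sA b a) => x _; rewrite mxE.
Qed.

Lemma mpartialM A C k x : msmooth A -> msmooth C -> U x ->
  mpartial k (fun y => A y *m C y) x = mpartial k A x *m C x + A x *m mpartial k C x.
Proof.
move=> sA sC Ux; apply/matrixP => a b; rewrite !mxE.
have -> : (fun y => (A y *m C y) a b) = (fun y => \sum_c A y a c * C y c b).
  by apply/funext => y; rewrite mxE.
rewrite (partial_sum oU) //; last by move=> c; exact: smoothM.
rewrite -big_split; apply: eq_bigr => c _.
by rewrite (partialM (U := U)) // !mxE.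
Qed.

Lemma mpartialD A B k x : msmooth A -> msmooth B -> U x ->
  mpartial k (fun y => A y + B y) x = mpartial k A x + mpartial k B x.
Proof.
move=> sA sB Ux; apply/matrixP => a b; rewrite !mxE.
have -> : (fun y => (A y + B y) a b) = (fun y => A y a b + B y a b).
  by apply/funext => y; rewrite mxE.
by rewrite (partialD (U := U)).
Qed.

Lemma mpartialB A B k x : msmooth A -> msmooth B -> U x ->
  mpartial k (fun y => A y - B y) x = mpartial k A x - mpartial k B x.
Proof.
move=> sA sB Ux; apply/matrixP => a b; rewrite !mxE.
have -> : (fun y => (A y - B y) a b) = (fun y => A y a b - B y a b).
  by apply/funext => y; rewrite !mxE.
by rewrite (partialB (U := U)).
Qed.

Lemma mpartialZ (f : 'rV[R]_n -> R) A k x : smooth_on U f -> msmooth A -> U x ->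
  mpartial k (fun y => f y *: A y) x = partial k f x *: A x + f x *: mpartial k A x.
Proof.
move=> sf sA Ux; apply/matrixP => a b; rewrite !mxE.
have -> : (fun y => (f y *: A y) a b) = (fun y => f y * A y a b).
  by apply/funext => y; rewrite !mxE.
by rewrite (partialM (U := U)).
Qed.

Lemma mpartial_tr A k x : mpartial k (fun y => (A y)^T) x = (mpartial k A x)^T.
Proof.
apply/matrixP => a b; rewrite !mxE; congr partial.
by apply/funext => y; rewrite mxE.
Qed.

Lemma mpartial_cst (A : 'M[R]_(p, q)) k x : mpartial k (fun=> A) x = 0.
Proof. by apply/matrixP => a b; rewrite !mxE partial_cst. Qed.

Lemma mpartialC A j k x : msmooth A -> U x ->
  mpartial j (mpartial k A) x = mpartial k (mpartial j A) x.
Proof.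
move=> sA Ux; apply/matrixP => a b.
have E (l : 'I_n) : (fun y => mpartial l A y a b) = partial l (fun y => A y a b).
  by apply/funext => y; rewrite mxE.
rewrite [LHS]mxE [RHS]mxE (E j) (E k); exact: (partialC oU).
Qed.

End Rules.

Lemma smooth_det m (A : 'rV[R]_n -> 'M[R]_m) : msmooth A ->
  smooth_on U (fun x => \det (A x)).
Proof.
move=> sA; apply: (smooth_sum oU) => s; apply: (smoothM oU).
  exact: smooth_cst.
by apply: (smooth_prod oU) => a; exact: sA.
Qed.

(** Cramer's formula: cofactors and determinant are polynomials in the entries. *)
Lemma msmooth_inv m (A : 'rV[R]_n -> 'M[R]_m) : msmooth A ->
  (forall x, U x -> A x \in unitmx) -> msmooth (fun x => invmx (A x)).
Proof.
move=> sA uA a b.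
have sC : smooth_on U (fun x => cofactor (A x) b a).
  apply: (smoothM oU); first exact: smooth_cst.
  apply: smooth_det => c d.
  by apply: (smooth_ext oU) (sA (lift b c) (lift a d)) => x _; rewrite !mxE.
have sD : smooth_on U (fun x => (\det (A x))^-1).
  apply: (smoothV oU); last exact: smooth_det.
  by move=> x /uA; rewrite unitmxE unitfE.
apply: (smooth_ext oU) (smoothM oU sD sC) => x /uA uAx.
by rewrite /invmx uAx !mxE.
Qed.

End MatrixCalculus.

(** * Levi-Civita connection in a chart *)

Section LeviCivita.
Variables (R : realType) (n : nat) (U : set 'rV[R]_n) (G : 'rV[R]_n -> 'M[R]_n).
Hypothesis oU : open U.
Hypothesis sG : msmooth U G.
Hypothesis symG : forall x, U x -> (G x)^T = G x.
Hypothesis posG : forall x (v : 'rV[R]_n), U x -> v != 0 -> 0 < (v *m G x *m v^T) 0 0.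
Implicit Types (x : 'rV[R]_n) (i j k l : 'I_n).

Definition inv_metric x := invmx (G x).
(** The connection matrix in direction [k]: a covector field [u] has covariant derivative
    [mpartial k u - u *m gam k], and [curvE] becomes the usual formula for the curvature of a
    connection. *)
Definition gam k x : 'M[R]_n := \matrix_(l, i) christoffel G l k i x.
Definition curv i j x : 'M[R]_n := \matrix_(l, k) riemann G l k i j x.
Definition ric x : 'M[R]_n := \matrix_(j, k) ricci G j k x.

Lemma metric_unit x : U x -> G x \in unitmx.
Proof.
move=> Ux; rewrite unitmxE unitfE; apply/negP => /det0P[v v0 vG].
by have := posG Ux v0; rewrite vG mul0mx mxE ltxx.
Qed.

Lemma inv_metricK x : U x -> inv_metric x *m G x = 1%:M.
Proof. by move=> /metric_unit uG; rewrite /inv_metric mulVmx. Qed.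

Lemma metricK x : U x -> G x *m inv_metric x = 1%:M.
Proof. by move=> /metric_unit uG; rewrite /inv_metric mulmxV. Qed.

Lemma inv_metric_sym x : U x -> (inv_metric x)^T = inv_metric x.
Proof. by move=> Ux; rewrite /inv_metric trmx_inv symG. Qed.

Lemma inv_metric_pos x (v : 'rV[R]_n) : U x -> v != 0 -> 0 < dot (inv_metric x) v v.
Proof.
move=> Ux v0; have w0 : v *m inv_metric x != 0.
  apply: contra_neq v0 => w0.
  by rewrite -[v]mulmx1 -(inv_metricK Ux) mulmxA w0 mul0mx.
have := posG Ux w0.
by rewrite -[v *m _ *m G x]mulmxA inv_metricK // mulmx1 trmx_mul inv_metric_sym // mulmxA.
Qed.

Lemma smooth_inv_metric : msmooth U inv_metric.
Proof. by apply: msmooth_inv => // x; exact: metric_unit. Qed.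

(** Twice the Christoffel symbols with the upper index lowered. *)
Let low k x : 'M[R]_n := \matrix_(m, i)
  (partial k (fun y => G y i m) x + partial i (fun y => G y k m) x
   - partial m (fun y => G y k i) x).

Let gamE k x : gam k x = 2^-1 *: (inv_metric x *m low k x).
Proof.
apply/matrixP => l i; rewrite !mxE; congr (_ * _).
by apply: eq_bigr => m _; rewrite mxE.
Qed.

Lemma smooth_gam k : msmooth U (gam k).
Proof.
have sL : msmooth U (low k).
  move=> m i; apply: (smooth_ext oU (f := fun x =>
    partial k (fun y => G y i m) x + partial i (fun y => G y k m) x
   - partial m (fun y => G y k i) x)); first by move=> x _; rewrite mxE.
  by apply: smoothB => //; first apply: smoothD => //; exact: smooth_partial.
move=> l i; have := msmooth_scale oU (smooth_cst oU 2^-1)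
  (msmooth_mul oU smooth_inv_metric sL) l i.
by apply: (smooth_ext oU) => x _; rewrite -gamE.
Qed.

Let partialG_sym i j k x : U x ->
  partial k (fun y => G y i j) x = partial k (fun y => G y j i) x.
Proof.
move=> Ux; apply: (partial_ext oU) => // y Uy.
by rewrite -[in LHS](symG Uy) mxE.
Qed.

Lemma gamC i k l x : U x -> gam k x l i = gam i x l k.
Proof.
move=> Ux; rewrite !mxE /christoffel; congr (_ * _); apply: eq_bigr => m _.
by rewrite (partialG_sym k i m Ux) [X in _ * (X - _) = _]addrC.
Qed.

Lemma metric_compat k x : U x -> mpartial k G x = (gam k x)^T *m G x + G x *m gam k x.
Proof.
move=> Ux.
have Gg : G x *m gam k x = 2^-1 *: low k x.
  by rewrite gamE -scalemxAr mulmxA metricK // mul1mx.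
have -> : (gam k x)^T *m G x = (G x *m gam k x)^T by rewrite trmx_mul symG.
rewrite Gg; apply/matrixP => m i; rewrite !mxE.
rewrite (partialG_sym m i k Ux) (partialG_sym k i m Ux) (partialG_sym k m i Ux).
by field.
Qed.

Lemma mpartial_inv_metric k x : U x ->
  mpartial k inv_metric x = - (gam k x *m inv_metric x + inv_metric x *m (gam k x)^T).
Proof.
move=> Ux.
have E : mpartial k inv_metric x *m G x +
    inv_metric x *m ((gam k x)^T *m G x + G x *m gam k x) = 0.
  rewrite -metric_compat // -(mpartialM oU) //; last exact: smooth_inv_metric.
  rewrite -[RHS](mpartial_cst (1%:M : 'M[R]_n) k x).
  by apply: (mpartial_ext oU) => // y Uy; exact: inv_metricK.
have := congr1 (mulmx^~ (inv_metric x)) E.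
rewrite mul0mx mulmxDl -[mpartial _ _ _ *m _ *m _]mulmxA metricK // mulmx1.
rewrite mulmxDr mulmxDl !mulmxA inv_metricK // mul1mx.
rewrite -[inv_metric x *m _ *m G x *m _]mulmxA metricK // mulmx1.
by move=> e; apply/eqP; rewrite -addr_eq0 [gam k x *m _ + _]addrC e.
Qed.

Lemma curvE i j x : U x -> curv i j x =
  mpartial i (gam j) x - mpartial j (gam i) x
  + (gam i x *m gam j x - gam j x *m gam i x).
Proof.
move=> Ux; apply/matrixP => l k; rewrite !mxE /riemann.
have gE a b c : (fun y => gam a y b c) = christoffel G b a c.
  by apply/funext => y; rewrite mxE.
rewrite !gE -sumrB; congr (_ + _); apply: eq_bigr => m _.
by rewrite !mxE.
Qed.

Lemma curvN i j x : U x -> curv i j x = - curv j i x.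
Proof.
move=> Ux; rewrite !curvE // opprD !opprB; congr (_ + _).
Qed.

Lemma smooth_curv i j : msmooth U (curv i j).
Proof.
have s1 := msmooth_partial oU i (smooth_gam j).
have s2 := msmooth_partial oU j (smooth_gam i).
have s3 := msmooth_mul oU (smooth_gam i) (smooth_gam j).
have s4 := msmooth_mul oU (smooth_gam j) (smooth_gam i).
have s := msmooth_add oU (msmooth_sub oU s1 s2) (msmooth_sub oU s3 s4).
by move=> l k; apply: (smooth_ext oU) (s l k) => x Ux; rewrite curvE.
Qed.

Lemma ricE j k x : ric x j k = \sum_i curv i j x i k.
Proof. by rewrite mxE /ricci; apply: eq_bigr => i _; rewrite mxE. Qed.

Lemma smooth_ric : msmooth U ric.
Proof.
move=> j k; have s i := smooth_curv i j i k.
apply: (smooth_ext oU) (smooth_sum oU (index_enum 'I_n) xpredT s) => x _.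
by rewrite ricE.
Qed.

(* Commuting the second partials of the metric. *)
Lemma curv_anti i j x : U x -> (G x *m curv i j x)^T = - (G x *m curv i j x).
Proof.
move=> Ux.
have D2 a b : mpartial a (mpartial b G) x =
    (mpartial a (gam b) x)^T *m G x
    + (gam b x)^T *m ((gam a x)^T *m G x + G x *m gam a x)
    + (((gam a x)^T *m G x + G x *m gam a x) *m gam b x
       + G x *m mpartial a (gam b) x).
  have -> : mpartial a (mpartial b G) x =
      mpartial a (fun y => (gam b y)^T *m G y + G y *m gam b y) x.
    by apply: (mpartial_ext oU) => // y Uy; exact: metric_compat.
  have st := msmooth_tr oU (smooth_gam b).
  have sb := smooth_gam b.
  rewrite (mpartialD (U := U)) //; [|exact: (msmooth_mul oU)|exact: (msmooth_mul oU)].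
  by rewrite !(mpartialM oU) // mpartial_tr metric_compat.
have E := mpartialC oU i j sG Ux; rewrite (D2 i j) (D2 j i) in E.
rewrite trmx_mul (symG Ux).
rewrite (curvE i j Ux).
move: E; move: (G x) (gam i x) (gam j x) (mpartial i (gam j) x) (mpartial j (gam i) x).
move=> g a b c d E.
have tD (A B : 'M[R]_n) : (A + B)^T = A^T + B^T by exact: linearD.
have tN (A : 'M[R]_n) : (- A)^T = - A^T by exact: linearN.
rewrite !(tD, tN) !trmx_mul.
move: E; rewrite !(mulmxDl, mulmxDr, mulNmx, mulmxN) !mulmxA.
move: (c^T *m g) (d^T *m g) (b^T *m a^T *m g) (a^T *m b^T *m g) (b^T *m g *m a)
  (a^T *m g *m b) (g *m a *m b) (g *m b *m a) (g *m c) (g *m d).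
move=> m1 m2 m3 m4 m5 m6 m7 m8 m9 m10 E.
apply/matrixP => p q; have := congr1 (fun M : 'M[R]_n => M p q) E.
by rewrite !mxE => e; lra.
Qed.

(** The connection is torsion-free: by [gamC] the six derivative terms and the six quadratic terms
    cancel in pairs. *)
Lemma curv_bianchi i j k l x : U x ->
  curv i j x l k + curv j k x l i + curv k i x l j = 0.
Proof.
move=> Ux.
have cE a b c : curv a b x l c =
    partial a (fun y => gam b y l c) x - partial b (fun y => gam a y l c) x
    + (\sum_m gam a x l m * gam b x m c - \sum_m gam b x l m * gam a x m c).
  have := congr1 (fun M : 'M[R]_n => M l c) (curvE a b Ux).
  rewrite [X in _ = X -> _]mxE [fun_of_matrix (_ - _) _ _]mxE.
  rewrite [fun_of_matrix (mpartial _ _ _) _ _]mxE [fun_of_matrix (- mpartial _ _ _) _ _]mxE.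
  rewrite [fun_of_matrix (mpartial _ _ _) _ _]mxE.
  rewrite [fun_of_matrix (_ *m _ - _) _ _]mxE [fun_of_matrix (_ *m _) _ _]mxE.
  by rewrite [fun_of_matrix (- (_ *m _)) _ _]mxE [fun_of_matrix (_ *m _) _ _]mxE.
have gE a b c : partial c (fun y => gam a y l b) x = partial c (fun y => gam b y l a) x.
  by apply: (partial_ext oU) => // y Uy; exact: gamC.
have sE a b c : \sum_m gam a x l m * gam b x m c = \sum_m gam a x l m * gam c x m b.
  by apply: eq_bigr => m _; rewrite (gamC b c m Ux).
rewrite (cE i j k) (cE j k i) (cE k i j).
move: (gE j k i) (gE i k j) (gE i j k) (sE i j k) (sE j i k) (sE k i j).
have cut (a1 a2 a3 a4 a5 a6 b1 b2 b3 b4 b5 b6 : R) : a1 = a6 -> a2 = a3 -> a5 = a4 ->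
    b1 = b6 -> b2 = b3 -> b5 = b4 ->
    a1 - a2 + (b1 - b2) + (a3 - a4 + (b3 - b4)) + (a5 - a6 + (b5 - b6)) = 0.
  by move=> -> -> -> -> -> ->; ring.
exact: cut.
Qed.

(** By the first Bianchi identity the antisymmetric part of Ricci is, up to a factor, the trace of
    the endomorphism [curv j k x]; that trace is zero because the endomorphism is skew for the
    metric. *)
Lemma ric_sym x : U x -> (ric x)^T = ric x.
Proof.
move=> Ux; apply/matrixP => k j; rewrite mxE !ricE.
apply/eqP; rewrite -subr_eq0 -sumrB.
have tr0 : \sum_i curv j k x i i = 0.
  have -> : \sum_i curv j k x i i = \tr (curv j k x) by [].
  have := curv_anti j k Ux => A.
  have : \tr (curv j k x) = - \tr (curv j k x).
    have E : curv j k x = inv_metric x *m (G x *m curv j k x).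
      by rewrite mulmxA inv_metricK // mul1mx.
    rewrite {1}E -mxtrace_tr trmx_mul A inv_metric_sym // mulNmx linearN /=.
    by rewrite mxtrace_mulC -E.
  lra.
have -> : \sum_i (curv i j x i k - curv i k x i j) = - \sum_i curv j k x i i; last first.
  by rewrite tr0 oppr0.
rewrite -sumrN; apply: eq_bigr => i _.
have := curv_bianchi i j k i Ux.
have := congr1 (fun M : 'M[R]_n => M i j) (curvN k i Ux); rewrite [in RHS]mxE => ->.
by move=> e; lra.
Qed.

End LeviCivita.

(** * Static potentials in a chart *)

Section StaticChart.
Variables (R : realType) (U : set 'rV[R]_3) (G : 'rV[R]_3 -> 'M[R]_3).
Hypothesis oU : open U.
Hypothesis sG : msmooth U G.
Hypothesis symG : forall x, U x -> (G x)^T = G x.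
Hypothesis posG : forall x (v : 'rV[R]_3), U x -> v != 0 -> 0 < (v *m G x *m v^T) 0 0.
Hypothesis scalG : forall x, U x -> scalar_curv G x = 0.
Implicit Types (x : 'rV[R]_3) (i j k l : 'I_3) (f : 'rV[R]_3 -> R).

Local Notation H := (inv_metric G).
Local Notation P := (ric G).

Let sH : msmooth U H := smooth_inv_metric oU sG posG.
Let sP : msmooth U P := smooth_ric oU sG posG.
Let sgam k : msmooth U (gam G k) := smooth_gam oU sG posG k.

(** The covariant derivative of Ricci in direction [k], as a bilinear form with both indices
    down. *)
Definition dric k x : 'M[R]_3 :=
  mpartial k P x - (gam G k x)^T *m P x - P x *m gam G k x.

Lemma ric_trace x : U x -> \sum_j \sum_k H x j k * P x j k = 0.
Proof.
move=> Ux; rewrite -[RHS](scalG Ux); apply: eq_bigr => j _; apply: eq_bigr => k _.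
by rewrite [P x j k]mxE.
Qed.

Lemma dric_sym k x : U x -> (dric k x)^T = dric k x.
Proof.
move=> Ux; have PT := ric_sym oU sG symG posG Ux.
have dPT : (mpartial k P x)^T = mpartial k P x.
  rewrite -mpartial_tr; apply: (mpartial_ext oU) => // y Uy.
  exact: (ric_sym oU sG symG posG Uy).
rewrite /dric.
have tD (A B : 'M[R]_3) : (A - B)^T = A^T - B^T by exact: linearB.
rewrite !tD dPT !trmx_mul PT trmxK -!addrA; congr (_ + _); exact: addrC.
Qed.

Let sum_tr (A B : 'M[R]_3) : B^T = B -> \sum_j \sum_k A j k * B j k = \tr (A *m B).
Proof.
move=> Bs; apply: eq_bigr => j _; rewrite mxE; apply: eq_bigr => k _.
by rewrite -[in LHS]Bs mxE.
Qed.

(** The derivative of the scalar curvature, which is zero: the connection terms produced by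
    [mpartial_inv_metric] are those that turn [mpartial i P] into [dric i]. *)
Lemma dric_trace i x : U x -> \sum_j \sum_k H x j k * dric i x j k = 0.
Proof.
move=> Ux; rewrite (sum_tr _ (dric_sym i Ux)).
have E : partial i (fun y => \tr (H y *m P y)) x = 0.
  rewrite -[RHS](partial_cst (0 : R) i x); apply: (partial_ext oU) => // y Uy.
  by rewrite -(sum_tr _ (ric_sym oU sG symG posG Uy)) ric_trace.
have E2 : partial i (fun y => \tr (H y *m P y)) x =
    \tr (mpartial i (fun y => H y *m P y) x).
  rewrite /mxtrace (partial_sum oU) //.
    by apply: eq_bigr => a _; rewrite [RHS]mxE.
  by move=> a; exact: (msmooth_mul oU sH sP).
move: E; rewrite E2 (mpartialM oU) // (mpartial_inv_metric oU sG symG posG) // => E.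
rewrite -E /dric.
have trD (A B : 'M[R]_3) : \tr (A + B) = \tr A + \tr B by exact: linearD.
have trN (A : 'M[R]_3) : \tr (- A) = - \tr A by exact: linearN.
rewrite !(mulmxDr, mulmxDl, mulNmx, mulmxN) !trD !trN trD !mulmxA.
rewrite [in RHS]mxtrace_mulC [P x *m _]mulmxA.
have -> : \tr (P x *m gam G i x *m H x) = \tr (H x *m P x *m gam G i x).
  by rewrite mxtrace_mulC mulmxA.
move: (\tr (H x *m P x *m gam G i x)) (\tr _) (\tr _) => a b c; lra.
Qed.

Lemma curv_ricE l k i j x : U x -> (G x *m curv G i j x) l k =
  G x l i * P x k j + P x l i * G x k j - G x l j * P x k i - P x l j * G x k i.
Proof.
move=> Ux.
apply: (@curv3_ricci R (G x) (H x) (P x) (fun i j => curv G i j x)).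
- exact: (inv_metricK posG Ux).
- exact: (inv_metric_sym symG Ux).
- exact: symG.
- exact: (ric_sym oU sG symG posG Ux).
- by move=> a b; exact: (curv_anti oU sG symG posG).
- by move=> a b; exact: (curvN _ _ _ Ux).
- by move=> a b; exact: ricE.
- exact: ric_trace.
Qed.

Lemma ric0_flat x : U x -> P x = 0 -> forall l k i j, riemann G l k i j x = 0.
Proof.
move=> Ux P0 l k i j.
have GC : G x *m curv G i j x = 0.
  apply/matrixP => a b; rewrite curv_ricE // P0 mxE ?mxE; ring.
have : curv G i j x = 0.
  by rewrite -[curv G i j x]mul1mx -(inv_metricK posG Ux) -mulmxA GC mulmx0.
by move=> /(congr1 (fun M : 'M[R]_3 => M l k)); rewrite !mxE.
Qed.


Definition static_on f := smooth_on U f /\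
  forall x i j, U x -> hessian G f i j x = f x * ricci G i j x.

Definition du f x : 'rV[R]_3 := \row_j partial j f x.

Lemma smooth_du f : static_on f -> msmooth U (du f).
Proof.
case=> sf _ a j; apply: (smooth_ext oU) (smooth_partial j sf) => x _.
by rewrite mxE.
Qed.

(** The static equation read as a first-order system for the row [du f], ready to be differentiated
    once more. *)
Lemma du_cov f i x : static_on f -> U x ->
  mpartial i (du f) x = du f x *m gam G i x + f x *: row i (P x).
Proof.
move=> [sf hf] Ux; apply/rowP => j.
have := hf x i j Ux; rewrite /hessian => e.
have -> : mpartial i (du f) x 0 j = partial i (partial j f) x.
  by rewrite mxE; congr partial; apply/funext => y; rewrite mxE.
have -> : partial i (partial j f) x = f x * ricci G i j x +
    \sum_k christoffel G k i j x * partial k f x by rewrite -e subrK.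
rewrite addrC mxE [(_ *m _) 0 j]mxE [fun_of_matrix (_ *: _) _ _]mxE [row _ _ _ _]mxE [P x i j]mxE.
congr (_ + _); apply: eq_bigr => k _.
by rewrite [du f x 0 k]mxE [gam G i x k j]mxE mulrC.
Qed.

(* Commuting the covariant derivatives of [df]. *)
Lemma ricci_identity f i j k x : static_on f -> U x ->
  du f x 0 i * P x j k - du f x 0 j * P x i k
  + f x * (dric i x j k - dric j x i k) = - (du f x *m curv G i j x) 0 k.
Proof.
move=> stf Ux; have sdu := smooth_du stf; have [sf _] := stf.
have sr a : msmooth U (fun y => row a (P y)).
  by move=> b c; apply: (smooth_ext oU) (sP a c) => y _; rewrite [RHS]mxE.
have drow a b : mpartial a (fun y => row b (P y)) x = row b (mpartial a P x).
  apply/matrixP => c d; rewrite !mxE; congr partial.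
  by apply/funext => y; rewrite mxE.
have D2 a b : mpartial a (mpartial b (du f)) x =
    (du f x *m gam G a x + f x *: row a (P x)) *m gam G b x
    + du f x *m mpartial a (gam G b) x
    + (du f x 0 a *: row b (P x) + f x *: row b (mpartial a P x)).
  have -> : mpartial a (mpartial b (du f)) x =
      mpartial a (fun y => du f y *m gam G b y + f y *: row b (P y)) x.
    by apply: (mpartial_ext oU) => // y Uy; exact: du_cov.
  rewrite (mpartialD (U := U)) //; last 2 first.
  - exact: (msmooth_mul oU).
  - exact: (msmooth_scale oU).
  rewrite (mpartialM oU) // (mpartialZ (U := U)) // drow (du_cov a stf Ux).
  by rewrite [du f x 0 a]mxE.
have E := mpartialC oU i j sdu Ux; rewrite (D2 i j) (D2 j i) in E.
rewrite (curvE G i j Ux) /dric.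
(* These are the connection terms acting on the first index of Ricci; they cancel in the Cotton
   tensor because the connection is torsion-free. *)
have gP : ((gam G i x)^T *m P x) j k = ((gam G j x)^T *m P x) i k.
  rewrite !mxE; apply: eq_bigr => l _.
  by rewrite [(gam G i x)^T j l]mxE [(gam G j x)^T i l]mxE (gamC oU symG j i l Ux).
have := congr1 (fun M : 'rV[R]_3 => M 0 k) E; move: gP.
move: (mpartial i P x) (mpartial j P x) (mpartial i (gam G j) x) (mpartial j (gam G i) x).
move: (P x) (gam G i x) (gam G j x) (du f x) (f x) => p a b u fx e1 e2 c d gP.
have mxD (q r : nat) (A B : 'M[R]_(q, r)) s t : (A + B) s t = A s t + B s t.
  by rewrite mxE.
have mxN (q r : nat) (A : 'M[R]_(q, r)) s t : (- A) s t = - A s t by rewrite mxE.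
have mxZ (q r : nat) z (A : 'M[R]_(q, r)) s t : (z *: A) s t = z * A s t.
  by rewrite mxE.
have rowE (A : 'M[R]_3) s t : row s A 0 t = A s t by rewrite mxE.
rewrite !(mulmxDl, mulmxDr, mulmxN) -!scalemxAl -!row_mul.
rewrite !(mxD, mxN, mxZ, rowE) gP !mulmxA.
move: (u *m a *m b) (u *m b *m a) (u *m c) (u *m d) => m1 m2 m3 m4.
move: (m1 0 k) (m2 0 k) (m3 0 k) (m4 0 k) => a1 a2 a3 a4.
move: ((p *m b) i k) ((p *m a) j k) ((_ *m p) i k) => a5 a6 a13.
move: (u 0 i) (u 0 j) (p i k) (p j k) (e1 j k) (e2 i k) => a7 a8 a9 a10 a11 a12.
move=> e; apply/eqP; rewrite -subr_eq0; apply/eqP.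
have {}e := congr1 (fun z => z - (a2 + fx * a6 + a4 + (a8 * a9 + fx * a12))) e.
rewrite subrr in e; rewrite -[RHS]e; ring.
Qed.

Lemma static_eq f x : static_on f -> U x -> forall i j k,
  2 * (du f x 0 i * P x j k - du f x 0 j * P x i k)
  + (du f x *m H x *m P x) 0 i * G x j k - (du f x *m H x *m P x) 0 j * G x i k
  + f x * (dric i x j k - dric j x i k) = 0.
Proof.
move=> stf Ux; apply: (@static_identity R 3 (G x) (H x) (P x) (fun i j => curv G i j x)
  (du f x) (f x) (fun i j k => dric i x j k - dric j x i k)).
- exact: (inv_metricK posG Ux).
- exact: symG.
- exact: (ric_sym oU sG symG posG Ux).
- by move=> l k i j; exact: curv_ricE.
- by move=> i j k; exact: ricci_identity.
Qed.

(** [static_div] yields [f] times the divergence, hence the restriction to points where [f] can be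
    divided out. *)
Lemma dric_div f x : static_on f -> U x -> f x != 0 ->
  forall k, \sum_m \sum_j H x m j * dric m x k j = 0.
Proof.
move=> stf Ux f0 k.
apply: (mulfI f0); rewrite mulr0.
apply: (@static_div R 3 (G x) (H x) (P x) (du f x) (f x) (fun i j k => dric i x j k)) => //.
- exact: (inv_metricK posG Ux).
- exact: (inv_metric_sym symG Ux).
- exact: symG.
- exact: (ric_sym oU sG symG posG Ux).
- exact: ric_trace.
- by move=> i; exact: dric_trace.
- exact: static_eq.
Qed.

Lemma ric_at_common_zero f1 f2 x : static_on f1 -> static_on f2 -> U x ->
  f1 x = 0 -> f2 x = 0 ->
  (forall a b : R, a *: du f1 x + b *: du f2 x = 0 -> a = 0 /\ b = 0) -> P x = 0.
Proof.
move=> st1 st2 Ux z1 z2 ind.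
have alg f : static_on f -> f x = 0 -> static_alg (G x) (H x) (P x) (du f x).
  move=> stf fx i j k; have := static_eq stf Ux i j k.
  by rewrite fx mul0r addr0.
apply: (static_alg_indep (inv_metricK posG Ux) (inv_metric_sym symG Ux)
  (ric_sym oU sG symG posG Ux) (symG Ux) _ (alg _ st1 z1) (alg _ st2 z2) ind).
by move=> w w0; exact: (inv_metric_pos symG posG Ux w0).
Qed.

(** Metric compatibility: the connection terms of the inverse metric are absorbed into the covariant
    derivatives of the two factors. *)
Lemma partial_dot (u v : 'rV[R]_3 -> 'rV[R]_3) k x : msmooth U u -> msmooth U v -> U x ->
  partial k (fun y => dot (H y) (u y) (v y)) x =
    dot (H x) (mpartial k u x - u x *m gam G k x) (v x)
    + dot (H x) (u x) (mpartial k v x - v x *m gam G k x).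
Proof.
move=> su sv Ux.
have svT := msmooth_tr oU sv.
have suH := msmooth_mul oU su sH.
transitivity (mpartial k (fun y => u y *m H y *m (v y)^T) x 0 0).
  by rewrite mxE.
rewrite (mpartialM oU k suH svT Ux) (mpartialM oU k su sH Ux) mpartial_tr.
rewrite (mpartial_inv_metric oU sG symG posG k Ux) /dot.
move: (mpartial k u x) (mpartial k v x) (gam G k x) (H x) (u x) (v x) => m1 m2 g h a b.
have tD (A B : 'rV[R]_3) : (A - B)^T = A^T - B^T by exact: linearB.
have mxD (A B : 'M[R]_1) s t : (A + B) s t = A s t + B s t by rewrite mxE.
have mxN (A : 'M[R]_1) s t : (- A) s t = - A s t by rewrite mxE.
rewrite tD trmx_mul !(mulmxDl, mulmxDr, mulmxN, mulNmx, opprD) !mulmxA.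
by rewrite !(mxD, mxN); ring.
Qed.

End StaticChart.

(** * The Killing field of two potentials and its invariant *)

Section TwoPotentials.
Variables (R : realType) (U : set 'rV[R]_3) (G : 'rV[R]_3 -> 'M[R]_3).
Variables f1 f2 : 'rV[R]_3 -> R.
Hypothesis oU : open U.
Hypothesis sG : msmooth U G.
Hypothesis symG : forall x, U x -> (G x)^T = G x.
Hypothesis posG : forall x (v : 'rV[R]_3), U x -> v != 0 -> 0 < (v *m G x *m v^T) 0 0.
Hypothesis scalG : forall x, U x -> scalar_curv G x = 0.
Hypothesis st1 : static_on U G f1.
Hypothesis st2 : static_on U G f2.
Implicit Types (x : 'rV[R]_3) (i j k l m : 'I_3).

Local Notation H := (inv_metric G).
Local Notation P := (ric G).

Let sH : msmooth U H := smooth_inv_metric oU sG posG.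
Let sP : msmooth U P := smooth_ric oU sG posG.
Let s1 : smooth_on U f1 := proj1 st1.
Let s2 : smooth_on U f2 := proj1 st2.
Let sd1 := smooth_du oU st1.
Let sd2 := smooth_du oU st2.

(* [killing] is a Killing field: its covariant derivative is the antisymmetric
   [killing_der]. *)
Definition killing x : 'rV[R]_3 := f2 x *: du f1 x - f1 x *: du f2 x.
Definition killing_der x : 'M[R]_3 :=
  (du f2 x)^T *m du f1 x - (du f1 x)^T *m du f2 x.
Definition killing_norm x := dot (H x) (killing x) (killing x).
Definition killing_ric x := dot (H x) (killing x *m H x *m P x) (killing x).
(** Where [Ric = mu (g - 3 w w / |w|^2)], [killing_ric] is [- 2 mu |w|^2], so this is
    [4 mu^2 |w|^6], written without roots or quotients. *)
Definition killing_inv x := killing_ric x * killing_ric x * killing_norm x.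

Lemma smooth_killing : msmooth U killing.
Proof. by apply: msmooth_sub => //; exact: msmooth_scale. Qed.

Lemma killing_der_anti x : (killing_der x)^T = - killing_der x.
Proof.
rewrite /killing_der; have tD (A B : 'M[R]_3) : (A - B)^T = A^T - B^T by exact: linearB.
by rewrite tD !trmx_mul !trmxK opprB.
Qed.

(** The two Hessian contributions are both [f1 f2 Ric] and cancel, which leaves products of first
    derivatives. *)
Lemma killing_cov m x : U x ->
  mpartial m killing x - killing x *m gam G m x = row m (killing_der x).
Proof.
move=> Ux; rewrite (mpartialB (U := U)) //; [|exact: msmooth_scale..].
rewrite !(mpartialZ (U := U)) // (du_cov m st1 Ux) (du_cov m st2 Ux).
have d1 : partial m f1 x = du f1 x 0 m by rewrite mxE.
have d2 : partial m f2 x = du f2 x 0 m by rewrite mxE.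
have rE (u v : 'rV[R]_3) : row m (u^T *m v) = u 0 m *: v.
  by apply/rowP => k; rewrite !mxE big_ord1 !mxE.
have rB (A B : 'M[R]_3) : row m (A - B) = row m A - row m B.
  by apply/rowP => k; rewrite !mxE.
rewrite d1 d2 /killing_der rB !rE /killing mulmxBl -!scalemxAl.
move: (du f1 x *m gam G m x) (du f2 x *m gam G m x) (row m _) => a b r.
move: (du f1 x) (du f2 x) => u v.
by apply/rowP => k; rewrite !mxE; ring.
Qed.

Lemma smooth_dot (u v : 'rV[R]_3 -> 'rV[R]_3) : msmooth U u -> msmooth U v ->
  smooth_on U (fun x => dot (H x) (u x) (v x)).
Proof.
move=> su sv.
exact: (msmooth_mul oU (msmooth_mul oU su sH) (msmooth_tr oU sv) 0 0).
Qed.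

Lemma smooth_killing_norm : smooth_on U killing_norm.
Proof. by apply: smooth_dot; exact: smooth_killing. Qed.

Lemma smooth_killing_ric : smooth_on U killing_ric.
Proof.
apply: smooth_dot; last exact: smooth_killing.
exact: (msmooth_mul oU (msmooth_mul oU smooth_killing sH) sP).
Qed.

Lemma smooth_killing_inv : smooth_on U killing_inv.
Proof.
have sS := smooth_killing_ric; have sW := smooth_killing_norm.
by apply: smoothM => //; exact: smoothM.
Qed.

Lemma partial_killing_norm x : U x ->
  du killing_norm x = 2 *: (killing x *m H x *m (killing_der x)^T).
Proof.
move=> Ux; apply/rowP => m; rewrite mxE /killing_norm.
rewrite (partial_dot oU sG symG posG m smooth_killing smooth_killing Ux).
rewrite (killing_cov m Ux) dotC ?(inv_metric_sym symG Ux) //.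
move: (killing x) (H x) (killing_der x) => w h A.
have -> : dot h w (row m A) = (w *m h *m A^T) 0 m.
  by rewrite /dot !mxE; apply: eq_bigr => j _; rewrite !mxE.
by rewrite [RHS]mxE; ring.
Qed.

(** Combining the identities of [f1] and [f2] with coefficients [f2] and [- f1] eliminates the
    Cotton tensor. *)
Lemma killing_alg x : U x -> static_alg (G x) (H x) (P x) (killing x).
Proof.
move=> Ux i j k.
have e1 := static_eq oU sG symG posG scalG st1 Ux i j k.
have e2 := static_eq oU sG symG posG scalG st2 Ux i j k.
move: e1 e2; rewrite /killing !mulmxBl -!scalemxAl.
move: (du f1 x *m H x *m P x) (du f2 x *m H x *m P x) (du f1 x) (du f2 x).
move=> q1 q2 u1 u2.
move: (_ - dric G j x i k) (G x j k) (G x i k) (P x j k) (P x i k) (f1 x) (f2 x).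
move=> C g1 g2 p1 p2 a b.
have mxD (A B : 'rV[R]_3) s t : (A - B) s t = A s t - B s t by rewrite !mxE.
have mxZ z (A : 'rV[R]_3) s t : (z *: A) s t = z * A s t by rewrite mxE.
rewrite !(mxD, mxZ) => e1 e2.
have := congr2 (fun y z => b * y - a * z) e1 e2.
rewrite !mulr0 subrr => e; rewrite -[RHS]e; ring.
Qed.

Lemma ric_killing x : U x -> (2 * killing_norm x ^+ 2) *: P x =
  killing_ric x *: (3 *: ((killing x)^T *m killing x) - killing_norm x *: G x).
Proof.
move=> Ux.
by have [] := static_alg_ricci (inv_metricK posG Ux) (inv_metric_sym symG Ux)
  (ric_sym oU sG symG posG Ux) (symG Ux) (killing_alg Ux).
Qed.

(** The covariant derivative of [ric_killing] in direction [m]. *)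
Lemma dric_killing x m j k : U x ->
  4 * killing_norm x * du killing_norm x 0 m * P x j k
  + 2 * killing_norm x ^+ 2 * dric G m x j k =
  du killing_ric x 0 m * (3 * killing x 0 j * killing x 0 k - killing_norm x * G x j k)
  + killing_ric x * (3 * (killing_der x m j * killing x 0 k
     + killing x 0 j * killing_der x m k) - du killing_norm x 0 m * G x j k).
Proof.
move=> Ux.
have sW := smooth_killing_norm; have sS := smooth_killing_ric.
have sw := smooth_killing; have swT := msmooth_tr oU sw.
have sww := msmooth_mul oU swT sw.
have c3 := smooth_cst oU (3 : R); have c2 := smooth_cst oU (2 : R).
have sWW := smoothM oU sW sW.
have E : mpartial m (fun y => (2 * (killing_norm y * killing_norm y)) *: P y) x =
    mpartial m (fun y => killing_ric y *: (3 *: ((killing y)^T *m killing y)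
       - killing_norm y *: G y)) x.
  by apply: (mpartial_ext oU) => // y Uy; exact: ric_killing.
move: E.
have s3ww := msmooth_scale oU c3 sww.
have sWG := msmooth_scale oU sW sG.
have sd := msmooth_sub oU s3ww sWG.
have s2W := smoothM oU c2 sWW.
rewrite (mpartialZ (U := U)) // (mpartialZ (U := U)) // (mpartialB (U := U)) //.
rewrite (mpartialZ (U := U)) // (mpartialZ (U := U)) // (mpartialM oU) //.
rewrite (partialM (U := U)) // (partialM (U := U)) // !partial_cst mul0r add0r scale0r add0r.
rewrite mpartial_tr (metric_compat oU symG posG m Ux).
have -> : mpartial m P x = dric G m x + ((gam G m x)^T *m P x + P x *m gam G m x).
  by rewrite /dric [X in _ = _ + X]addrC addrA !subrK.
have -> : mpartial m killing x = row m (killing_der x) + killing x *m gam G m x.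
  by rewrite -killing_cov // subrK.
have -> : partial m killing_norm x = du killing_norm x 0 m by rewrite mxE.
have -> : partial m killing_ric x = du killing_ric x 0 m by rewrite mxE.
move: (ric_killing Ux).
move: (killing_norm x) (killing_ric x) (du killing_norm x 0 m) (du killing_ric x 0 m).
move: (killing x) (killing_der x) (P x) (G x) (dric G m x) (gam G m x).
move=> w A p g dp c W S W1 S1 star.
(* The connection terms on the two sides match by [ric_killing] itself, multiplied by the connection
   matrix on the left and on the right. *)
have := congr1 (fun M => c^T *m M) star; have := congr1 (fun M => M *m c) star.
rewrite /= -!(scalemxAr, scalemxAl) !(mulmxBr, mulmxBl) -!(scalemxAr, scalemxAl).
have tD (B C : 'rV[R]_3) : (B + C)^T = B^T + C^T by exact: linearD.
rewrite tD trmx_mul mulmxDl mulmxDr !mulmxA.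
have -> : (row m A)^T *m w = \matrix_(a, b) (A m a * w 0 b).
  by apply/matrixP => a b; rewrite !mxE big_ord1 !mxE.
have -> : w^T *m row m A = \matrix_(a, b) (w 0 a * A m b).
  by apply/matrixP => a b; rewrite !mxE big_ord1 !mxE.
have -> : w^T *m w = \matrix_(a, b) (w 0 a * w 0 b).
  by apply/matrixP => a b; rewrite !mxE big_ord1 !mxE.
move: (c^T *m p) (p *m c) (c^T *m g) (g *m c) (c^T *m w^T *m w) (w^T *m w *m c).
move=> x1 x2 x3 x4 x5 x6 e1 e2 e3 {star}.
have := congr1 (fun M : 'M[R]_3 => M j k) e1.
have := congr1 (fun M : 'M[R]_3 => M j k) e2.
have := congr1 (fun M : 'M[R]_3 => M j k) e3.
rewrite !mxE => a3 a2 a1; lra.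
Qed.

(** With [S] for [killing_ric] and [W] for [killing_norm], the derivative of [S^2 W] is
    [S (2 W dS + S dW)]. The bracket vanishes by [killing_ricci_gradient] if [W <> 0]; otherwise
    [w = 0], hence [S = 0]. *)
Lemma killing_inv_cst x k : U x -> partial k killing_inv x = 0.
Proof.
move=> Ux; have sW := smooth_killing_norm; have sS := smooth_killing_ric.
rewrite /killing_inv (partialM (U := U)) ?(partialM (U := U)) //; last exact: smoothM.
have -> : partial k killing_norm x = du killing_norm x 0 k by rewrite mxE.
have -> : partial k killing_ric x = du killing_ric x 0 k by rewrite mxE.
have [W0|W0] := eqVneq (killing_norm x) 0.
  have w0 : killing x = 0.
    apply/eqP; apply/negPn/negP => /(inv_metric_pos symG posG Ux).
    by rewrite -/(killing_norm x) W0 ltxx.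
  have -> : killing_ric x = 0 by rewrite /killing_ric w0 /dot !mul0mx mxE.
  by rewrite W0; ring.
(* If both potentials vanished here, [w] and so [killing_norm x] would be zero; thus [dric_div]
   applies to one of them. *)
have div l : \sum_m \sum_j H x m j * dric G m x l j = 0.
  have [z1|z1] := eqVneq (f1 x) 0; last first.
    exact: (dric_div oU sG symG posG scalG st1 Ux z1).
  have [z2|z2] := eqVneq (f2 x) 0; last first.
    exact: (dric_div oU sG symG posG scalG st2 Ux z2).
  move: W0; rewrite /killing_norm /killing z1 z2 !scale0r subrr /dot !mul0mx mxE.
  by rewrite eqxx.
have := @killing_ricci_gradient R 3 (G x) (H x) (P x) (fun m => dric G m x) (killing x)
  (killing_der x) (du killing_norm x) (du killing_ric x) (killing_ric x) W0
  (inv_metricK posG Ux) (inv_metric_sym symG Ux) (symG Ux)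
  (ric_sym oU sG symG posG Ux) (killing_der_anti x) (partial_killing_norm Ux)
  (ric_killing Ux) (fun m j k => dric_killing m j k Ux) div
  (fun m => dric_sym oU sG symG posG m Ux) k.
rewrite -/(killing_norm x).
move: (killing_norm x) (killing_ric x) (du killing_norm x 0 k) (du killing_ric x 0 k) => W S W1 S1 e.
have -> : (S1 * S + S * S1) * W + S * S * W1 = S * (2 * W * S1 + S * W1) by ring.
by rewrite e mulr0.
Qed.

Lemma partial_dot_du f h k x : static_on U G f -> static_on U G h -> U x ->
  partial k (fun y => dot (H y) (du f y) (du h y)) x =
    f x * (du h x *m H x *m P x) 0 k + h x * (du f x *m H x *m P x) 0 k.
Proof.
move=> stf sth Ux.
rewrite (partial_dot oU sG symG posG k (smooth_du oU stf) (smooth_du oU sth) Ux).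
rewrite (du_cov k stf Ux) (du_cov k sth Ux).
have cancel (a b : 'rV[R]_3) : a + b - a = b by rewrite addrAC subrr add0r.
rewrite !cancel dotZl dotZr.
have PT := ric_sym oU sG symG posG Ux.
have rE u : dot (H x) u (row k (P x)) = (u *m H x *m P x) 0 k.
  rewrite /dot -[in RHS]PT !mxE; apply: eq_bigr => j _; by rewrite !mxE.
by rewrite (dotC _ _ (inv_metric_sym symG Ux)) !rE.
Qed.

(* By [partial_dot_du] the hypothesis says that the functions [dot (du f) (du h)]
   are stationary. Their chart invariance only needs the chain rule, so vanishing of
   [killing_inv] passes between charts without the transformation law of curvature. *)
Lemma killing_inv_eq0 x : U x ->
  (forall k f h, (f = f1 \/ f = f2) -> (h = f1 \/ h = f2) ->
     f x * (du h x *m H x *m P x) 0 k + h x * (du f x *m H x *m P x) 0 k = 0) ->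
  killing_inv x = 0.
Proof.
move=> Ux E0; rewrite /killing_inv; suff -> : killing_ric x = 0 by rewrite !mul0r.
have q11 k := E0 k f1 f1 (or_introl erefl) (or_introl erefl).
have q12 k := E0 k f1 f2 (or_introl erefl) (or_intror erefl).
have q22 k := E0 k f2 f2 (or_intror erefl) (or_intror erefl).
rewrite /killing_ric; suff -> : killing x *m H x *m P x = 0 by rewrite /dot !mul0mx mxE.
apply/rowP => k; move: (q11 k) (q12 k) (q22 k).
rewrite /killing !mulmxBl -!scalemxAl.
move: (du f1 x *m H x *m P x) (du f2 x *m H x *m P x) (f1 x) (f2 x) => r1 r2 a b.
rewrite !mxE; move: (r1 0 k) (r2 0 k) => y z e1 e2 e3.
have ay : a * y = 0 by lra.
have bz : b * z = 0 by lra.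
have [a0|a0] := eqVneq a 0.
  have [b0|b0] := eqVneq b 0; first by rewrite a0 b0; ring.
  have z0 : z = 0 by apply: (mulfI b0); rewrite bz mulr0.
  rewrite z0 in e2 *; lra.
have y0 : y = 0 by apply: (mulfI a0); rewrite ay mulr0.
rewrite y0 in e2 *; lra.
Qed.

Lemma ric0_of_killing_inv x : U x -> killing_inv x = 0 -> killing x != 0 -> P x = 0.
Proof.
move=> Ux K0 w0; have W0 := inv_metric_pos symG posG Ux w0.
rewrite -/(killing_norm x) in W0.
have S0 : killing_ric x = 0.
  move/eqP: K0; rewrite /killing_inv !mulf_eq0 (gt_eqF W0) orbF orbb.
  by move/eqP.
have := ric_killing Ux; rewrite S0 scale0r => /eqP.
by rewrite scaler_eq0 mulf_eq0 pnatr_eq0 expf_eq0 (gt_eqF W0) /= => /eqP.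
Qed.

End TwoPotentials.

(** * Globalisation *)

Section Charts.
Variables (R : realType) (n : nat) (M : topologicalType).
Implicit Types (c : chart R n M) (q : M) (x : 'rV[R]_n).

Lemma chart_map_near c q (V : set 'rV[R]_n) : chart_dom c q ->
  nbhs (chart_map c q) V -> \forall r \near q, chart_dom c r /\ V (chart_map c r).
Proof.
move=> dq Vq.
have n1 : nbhs q (chart_dom c) by apply: open_nbhs_nbhs; split=> //; exact: chart_dom_open.
have n2 : nbhs q (chart_map c @^-1` V).
  exact: (chart_map_continuous (mem_set dq) Vq).
exact: filterI n1 n2.
Qed.

Lemma chart_inv_near c x (A : set M) : chart_cod c x ->
  nbhs (chart_inv c x) A -> nbhs x (chart_inv c @^-1` A).
Proof. by move=> cx Ax; exact: (chart_inv_continuous (mem_set cx) Ax). Qed.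

Lemma overlap_open (c c' : chart R n M) : open (overlap c c').
Proof.
rewrite openE => x [cx dx]; rewrite /interior.
have n1 : nbhs x (chart_cod c) by apply: open_nbhs_nbhs; split=> //; exact: chart_cod_open.
have n2 : nbhs x (chart_inv c @^-1` chart_dom c').
  apply: chart_inv_near => //; apply: open_nbhs_nbhs; split=> //; exact: chart_dom_open.
exact: (filterI n1 n2).
Qed.

End Charts.

Lemma connected_clopen (T : topologicalType) (Z : set T) : connected [set: T] ->
  Z !=set0 -> (forall q, Z q -> nbhs q Z) -> (forall q, closure Z q -> Z q) ->
  forall q, Z q.
Proof.
move=> cT Z0 oZ cZ q.
have -> : Z = [set: T]; last by [].
apply: cT => //.
  by exists Z; [rewrite openE => r /oZ|rewrite setTI].
by exists Z; [move=> r /cZ|rewrite setTI].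
Qed.

(** * Unique continuation of static potentials in a chart *)

Section LocalUniqueness.
Variables (R : realType) (U : set 'rV[R]_3) (G : 'rV[R]_3 -> 'M[R]_3).
Hypothesis oU : open U.
Hypothesis sG : msmooth U G.
Hypothesis posG : forall x (v : 'rV[R]_3), U x -> v != 0 -> 0 < (v *m G x *m v^T) 0 0.

(** The box depends on the metric alone, and the 1-jet may vanish at any of its points. The
    closedness argument relies on the latter: a point near the centre of the box is where the
    vanishing is known. *)
Lemma static_uniqueness x : U x -> exists2 r, 0 < r & box x r `<=` U /\
  forall f, static_on U G f -> forall y z, box x r y -> box x r z ->
    f y = 0 -> du f y = 0 -> f z = 0.
Proof.
move=> Ux.
have sgam k := smooth_gam oU sG posG k.
have sP := smooth_ric oU sG posG.
have near1 (h : 'rV[R]_3 -> R) : smooth_on U h -> nbhs x [set y | `|h x - h y| < 1].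
  by move=> sh; apply: continuous_near => //; exact: smooth_continuous sh Ux.
have nP : nbhs x [set y | forall i j, `|ric G x i j - ric G y i j| < 1].
  apply: (@filter_forall _ _ _ (nbhs x)) => i.
  by apply: (@filter_forall _ _ _ (nbhs x)) => j; exact: near1 (sP i j).
have ng : nbhs x [set y | forall k i j, `|gam G i x k j - gam G i y k j| < 1].
  apply: (@filter_forall _ _ _ (nbhs x)) => k.
  apply: (@filter_forall _ _ _ (nbhs x)) => i.
  by apply: (@filter_forall _ _ _ (nbhs x)) => j; exact: near1 (sgam i k j).
have nU : nbhs x U by exact: open_nbhs_nbhs.
have [r r0 rN] := nbhs_box (filterI nU (filterI nP ng)).
have bU : box x r `<=` U by move=> y /rN [].
exists r => //; split=> // f stf y z yx zx fy dfy.
(* The sums bound Ricci and the Christoffel symbols at [x]; the 1 absorbs their variation over the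
   box. *)
pose K := 1 + \sum_i \sum_j (`|ric G x i j| + \sum_k `|gam G i x k j|).
have Kge i j : `|ric G x i j| + \sum_k `|gam G i x k j| <= K - 1.
  rewrite /K addrAC subrr add0r; pose t i j := `|ric G x i j| + \sum_k `|gam G i x k j|.
  have t0 a b : 0 <= t a b by rewrite addr_ge0 ?sumr_ge0.
  rewrite -/(t i j) -[leRHS]/(\sum_i \sum_j t i j) (bigD1 i) //= (bigD1 j) //= -addrA lerDl addr_ge0 ?sumr_ge0 //.
  by move=> a _; rewrite sumr_ge0.
have sum0 i j : 0 <= \sum_k `|gam G i x k j| by rewrite sumr_ge0.
have [||//] := @second_order_uniqueness R 3 U oU f x r K (proj1 stf) bU _ y z yx zx fy.
- move=> w i j wx; have [Uw [Pw gw]] := rN _ wx.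
  have := proj2 stf w i j Uw; rewrite /hessian => e.
  have -> : partial i (partial j f) w = f w * ricci G i j w +
    \sum_k christoffel G k i j w * partial k f w by rewrite -e subrK.
  rewrite mulrDr; apply: le_trans (ler_normD _ _) _; apply: lerD.
    rewrite normrM mulrC ler_wpM2r //.
    have := Pw i j; rewrite [ric G w i j]mxE.
    have := Kge i j; have := sum0 i j.
    have := ler_distD (ric G x i j) 0 (ricci G i j w); rewrite !sub0r !normrN.
    lra.
  rewrite mulr_sumr; apply: le_trans (ler_norm_sum _ _ _) _.
  apply: ler_sum => k _; rewrite normrM ler_wpM2r //.
  have := gw k i j; rewrite [gam G i w k j]mxE.
  have := Kge i j; have : `|gam G i x k j| <= \sum_k `|gam G i x k j|.
    by rewrite (bigD1 k) //= lerDl sumr_ge0.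
  have := normr_ge0 (ric G x i j).
  have := ler_distD (gam G i x k j) 0 (christoffel G k i j w); rewrite !sub0r !normrN.
  lra.
by move=> k; have := congr1 (fun v : 'rV[R]_3 => v 0 k) dfy; rewrite !mxE.
Qed.

End LocalUniqueness.

Lemma static_on_comb (R : realType) (U : set 'rV[R]_3) (G : 'rV[R]_3 -> 'M[R]_3)
    (f h : 'rV[R]_3 -> R) (a b : R) : open U -> static_on U G f -> static_on U G h ->
  static_on U G (fun y => a * f y + b * h y) /\
  forall x, U x -> du (fun y => a * f y + b * h y) x = a *: du f x + b *: du h x.
Proof.
move=> oU [sf hf] [sh hh].
have sa := smooth_cst oU a; have sb := smooth_cst oU b.
have dlin u v j x : smooth_on U u -> smooth_on U v -> U x ->
    partial j (fun y => a * u y + b * v y) x = a * partial j u x + b * partial j v x.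
  move=> su sv Ux; rewrite (partialD (U := U)) //; [|exact: smoothM..].
  rewrite (partialM j sa su Ux) (partialM j sb sv Ux) !partial_cst.
  by rewrite !mul0r !add0r.
have d j x Ux := dlin f h j x sf sh Ux.
split; last by move=> x Ux; apply/rowP => j; rewrite !mxE d.
split; first by apply: smoothD => //; exact: smoothM.
move=> x i j Ux.
have -> : hessian G (fun y => a * f y + b * h y) i j x =
    a * hessian G f i j x + b * hessian G h i j x; last by rewrite hf // hh //; ring.
rewrite /hessian.
rewrite (partial_ext oU (g := fun y => a * partial j f y + b * partial j h y)) //; last first.
  by move=> y Uy; exact: d.
have sjf := smooth_partial j sf; have sjh := smooth_partial j sh.
rewrite (dlin _ _ _ _ sjf sjh Ux).
have -> : \sum_k christoffel G k i j x * partial k (fun y => a * f y + b * h y) x =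
    a * (\sum_k christoffel G k i j x * partial k f x) +
    b * (\sum_k christoffel G k i j x * partial k h x).
  by rewrite !mulr_sumr -big_split /=; apply: eq_bigr => k _; rewrite d //; ring.
by move: (\sum_k _) (\sum_k _) (partial i _ x) (partial i _ x) => S1 S2 d1 d2; ring.
Qed.

(** * Connectedness arguments and change of chart *)

Section Global.
Variables (R : realType) (M : smooth_manifold R 3) (g : riemannian_metric M).
Hypothesis conM : connected [set: M].
Hypothesis scal0 : zero_scalar_curv g.
Implicit Types (c : chart R 3 M) (f h : M -> R) (q : M) (x : 'rV[R]_3).

Local Notation loc f c := (fun x => f (chart_inv c x)).
Local Notation Gm c := (metric_mx g c).
Local Notation openU c := (@chart_cod_open R 3 M c).

Lemma metric_smooth_mx c : atlas c -> msmooth (chart_cod c) (Gm c).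
Proof. by move=> ac i j; exact: (metric_smooth g ac). Qed.

Lemma metric_sym_mx c : atlas c -> forall x, chart_cod c x -> (Gm c x)^T = Gm c x.
Proof. by move=> ac x; exact: (Defs.metric_sym g ac). Qed.

Lemma metric_pos_mx c : atlas c -> forall x (v : 'rV[R]_3), chart_cod c x -> v != 0 ->
  0 < (v *m Gm c x *m v^T) 0 0.
Proof. by move=> ac x v; exact: (metric_posdef g ac). Qed.

Lemma scalar_mx c : atlas c -> forall x, chart_cod c x -> scalar_curv (Gm c) x = 0.
Proof. by move=> ac x; exact: scal0. Qed.

Lemma static_loc f c : static_potentials g f -> atlas c ->
  static_on (chart_cod c) (Gm c) (loc f c).
Proof.
by move=> [sf hf] ac; split; [exact: sf|move=> x i j cx; exact: hf].
Qed.

Lemma static_comb f h (a b : R) : static_potentials g f -> static_potentials g h ->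
  static_potentials g (fun q => a * f q + b * h q).
Proof.
move=> pf ph.
have st c (ac : atlas c) := static_on_comb a b (openU c) (static_loc pf ac)
  (static_loc ph ac).
split=> [c ac|c x ac cx i j]; first by have [[]] := st c ac.
by have [[_ +] _] := st c ac; apply.
Qed.

(** A static potential is determined by its 1-jet at one point. At a closure point of [Z], local
    uniqueness is started from a nearby point of [Z], around which [f] and hence [du] vanish. *)
Lemma static_vanish f c x : static_potentials g f -> atlas c -> chart_cod c x ->
  f (chart_inv c x) = 0 -> du (loc f c) x = 0 -> forall q, f q = 0.
Proof.
move=> pf ac cx fx dfx.
(* Vanishing near [q], unlike vanishing of the 1-jet at [q], refers to no chart, and makes [Z] open
   at once. *)
pose Z : set M := [set q | \forall r \near q, f r = 0].
have uniq c0 y : atlas c0 -> chart_cod c0 y -> exists2 r, 0 < r &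
    forall w z, box y r w -> box y r z -> f (chart_inv c0 w) = 0 ->
      du (loc f c0) w = 0 -> f (chart_inv c0 z) = 0.
  move=> ac0 cy.
  have [r r0 [_ ru]] := static_uniqueness (openU c0) (metric_smooth_mx ac0)
    (metric_pos_mx ac0) cy.
  exists r => // w z wy zy; exact: (ru _ (static_loc pf ac0)).
have boxZ c0 q r : chart_dom c0 q -> 0 < r ->
    (forall z, box (chart_map c0 q) r z -> f (chart_inv c0 z) = 0) -> Z q.
  move=> dq r0 f0; have := chart_map_near dq (box_nbhs _ r0).
  by apply: filterS => s [ds bs]; rewrite -(chart_mapK ds) f0.
suff Zall q : Z q by move=> q; exact: nbhs_singleton (Zall q).
apply: connected_clopen conM _ _ _ q.
- exists (chart_inv c x); have [r r0 ru] := uniq c x ac cx.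
  apply: (boxZ c _ r (chart_inv_dom cx) r0); rewrite chart_invK // => z zx.
  by apply: (ru x z) => //; exact: box_center.
- by move=> q; rewrite /Z /= => /nbhs_interior.
move=> q clq; have [c0 ac0 dq] := atlas_cover q.
have [r r0 ru] := uniq c0 _ ac0 (chart_map_cod dq).
have [s [Zs [ds bs]]] := clq _ (chart_map_near dq (box_nbhs _ r0)).
have cs := chart_map_cod ds.
have near0 : \forall y \near chart_map c0 s, f (chart_inv c0 y) = 0.
  by apply: (chart_inv_near cs (A := [set r | f r = 0])); rewrite chart_mapK.
apply: (boxZ c0 _ r dq r0) => z zb.
apply: (ru (chart_map c0 s) z) => //; first exact: nbhs_singleton near0.
apply/rowP => k; rewrite !mxE -(partial_cst (0 : R) k (chart_map c0 s)).
exact: near_eq_derive.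
Qed.

Definition independent f h := forall a b : R,
  (forall q, a * f q + b * h q = 0) -> a = 0 /\ b = 0.

Lemma du_independent f h c x : static_potentials g f -> static_potentials g h ->
  independent f h -> atlas c -> chart_cod c x ->
  f (chart_inv c x) = 0 -> h (chart_inv c x) = 0 ->
  forall a b : R, a *: du (loc f c) x + b *: du (loc h c) x = 0 -> a = 0 /\ b = 0.
Proof.
move=> pf ph ind ac cx fx hx a b e; apply: ind => q.
apply: (static_vanish (static_comb a b pf ph) ac cx).
  by rewrite fx hx !mulr0 addr0.
have [_ ->//] := static_on_comb a b (openU c) (static_loc pf ac)
    (static_loc ph ac).
Qed.

Lemma common_zero_ric f h c x : static_potentials g f -> static_potentials g h ->
  independent f h -> atlas c -> chart_cod c x ->
  f (chart_inv c x) = 0 -> h (chart_inv c x) = 0 -> ric (Gm c) x = 0.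
Proof.
move=> pf ph ind ac cx fx hx.
apply: (ric_at_common_zero (openU c) (metric_smooth_mx ac) (metric_sym_mx ac)
  (metric_pos_mx ac) (scalar_mx ac) (static_loc pf ac) (static_loc ph ac) cx fx hx).
exact: du_independent.
Qed.

Lemma flat_of_ric0 : (forall c x, atlas c -> chart_cod c x -> ric (Gm c) x = 0) -> flat g.
Proof.
move=> ric0 c x ac cx.
exact: (ric0_flat (openU c) (metric_smooth_mx ac) (metric_sym_mx ac)
  (metric_pos_mx ac) (scalar_mx ac) cx (ric0 c x ac cx)).
Qed.

(** With [J] the Jacobian of the transition, differentials transform by [J^T] and the metric by
    [J G J^T]; only first derivatives are involved. *)
Lemma dot_du_invariant f h c c' x : static_potentials g f -> static_potentials g h ->
  atlas c -> atlas c' -> overlap c c' x ->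
  dot (inv_metric (Gm c) x) (du (loc f c) x) (du (loc h c) x) =
  dot (inv_metric (Gm c') (transition c c' x))
    (du (loc f c') (transition c c' x)) (du (loc h c') (transition c c' x)).
Proof.
move=> pf ph ac ac' ox; have [cx dx] := ox.
set T := transition c c'.
have cTx : chart_cod c' (T x) by exact: chart_map_cod.
pose J : 'M[R]_3 := \matrix_(i, k) partial i (fun y => T y 0 k) x.
have duJ f0 : static_potentials g f0 ->
    du (loc f0 c) x = du (loc f0 c') (T x) *m J^T.
  move=> p0; apply/rowP => i; rewrite !mxE.
  transitivity (partial i (fun y => loc f0 c' (T y)) x).
    apply: (partial_ext (@overlap_open _ _ _ c c')) => // y [cy dy].
    by rewrite /T /transition chart_mapK.
  rewrite (partial_comp i (@overlap_open _ _ _ c c') (openU c')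
    (atlas_smooth ac ac') (proj1 (static_loc p0 ac')) ox cTx).
  by apply: eq_bigr => k _; rewrite !mxE mulrC.
have GJ : Gm c x = J *m Gm c' (T x) *m J^T.
  apply/matrixP => i j; rewrite (metric_transition g i j ac ac' ox).
  rewrite mxE exchange_big; apply: eq_bigr => l _; rewrite mxE mulr_suml.
  by apply: eq_bigr => k _; rewrite !mxE; ring.
have HG := inv_metricK (metric_pos_mx ac) cx.
have GH' := metricK (metric_pos_mx ac') cTx.
rewrite (duJ f pf) (duJ h ph) /dot.
move: HG GH' GJ; move: (inv_metric (Gm c) x) (inv_metric (Gm c') (T x)).
move: (Gm c x) (Gm c' (T x)) (du (loc f c') (T x)) (du (loc h c') (T x)).
move=> G1 G2 u v H1 H2 HG GH' GJ.
(* The transformed metric has [H1] as inverse, so [H1 J G2] is a left inverse of [J^T]; for square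
   matrices it is also a right inverse, which exhibits [J^T H1 J] as the inverse of [G2]. *)
suff -> : H2 = J^T *m H1 *m J by rewrite trmx_mul trmxK !mulmxA.
have e1 : (H1 *m J *m G2) *m J^T = 1%:M by rewrite -HG GJ !mulmxA.
have e2 : J^T *m (H1 *m J *m G2) = 1%:M by exact: mulmx1C.
by rewrite -[LHS]mul1mx -e2 -!mulmxA GH' mulmx1.
Qed.

Section TwoFunctions.
Variables f1 f2 : M -> R.
Hypothesis p1 : static_potentials g f1.
Hypothesis p2 : static_potentials g f2.
Hypothesis ind : independent f1 f2.

Local Notation kinv c := (killing_inv (Gm c) (loc f1 c) (loc f2 c)).

Lemma killing_inv_local c x : atlas c -> chart_cod c x ->
  exists2 r, 0 < r & box x r `<=` chart_cod c /\
    forall y z, box x r y -> box x r z -> kinv c z = kinv c y.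
Proof.
move=> ac cx.
have nU : nbhs x (chart_cod c) by apply: open_nbhs_nbhs; split=> //; exact: chart_cod_open.
have [r r0 bU] := nbhs_box nU.
exists r; first exact: r0.
split; first exact: bU.
apply: (partial0_box bU).
  exact: (smooth_killing_inv (openU c) (metric_smooth_mx ac) (metric_pos_mx ac)
    (static_loc p1 ac) (static_loc p2 ac)).
move=> y i /bU cy.
exact: (killing_inv_cst (openU c) (metric_smooth_mx ac) (metric_sym_mx ac)
  (metric_pos_mx ac) (scalar_mx ac) (static_loc p1 ac) (static_loc p2 ac) i cy).
Qed.

(** The potential [f2(x) f1 - f1(x) f2] vanishes at [x] and its differential there is [w(x)]. If
    that is zero the potential is identically zero, and independence kills both coefficients. *)
Lemma killing0 c x : atlas c -> chart_cod c x ->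
  killing (loc f1 c) (loc f2 c) x = 0 ->
  f1 (chart_inv c x) = 0 /\ f2 (chart_inv c x) = 0.
Proof.
move=> ac cx k0.
set a := f1 _; set b := f2 _.
have [] := ind (a := b) (b := - a); last by move=> -> /eqP; rewrite oppr_eq0 => /eqP.
move=> q; apply: (static_vanish (static_comb b (- a) p1 p2) ac cx).
  by rewrite -/a -/b; ring.
have [_ ->//] := static_on_comb b (- a) (openU c) (static_loc p1 ac)
    (static_loc p2 ac).
by rewrite scaleNr.
Qed.

Lemma ric0_killing_inv c x : atlas c -> chart_cod c x -> kinv c x = 0 ->
  ric (Gm c) x = 0.
Proof.
move=> ac cx K0.
have [w0|w0] := eqVneq (killing (loc f1 c) (loc f2 c) x) 0.
  by have [z1 z2] := killing0 ac cx w0; exact: (common_zero_ric p1 p2 ind).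
exact: (ric0_of_killing_inv (openU c) (metric_smooth_mx ac) (metric_sym_mx ac)
  (metric_pos_mx ac) (scalar_mx ac) (static_loc p1 ac) (static_loc p2 ac) cx K0 w0).
Qed.

(** Vanishing at one point of the first chart spreads to a box, where Ricci is then zero and the
    functions [dot (du f) (du h)] are constant. Being chart invariant, they are also stationary at
    [q] in the second chart, which is the hypothesis of [killing_inv_eq0]. *)
Lemma killing_inv_transfer c c' q : atlas c -> atlas c' -> chart_dom c q -> chart_dom c' q ->
  kinv c (chart_map c q) = 0 -> kinv c' (chart_map c' q) = 0.
Proof.
move=> ac ac' dq dq' K0.
have cq := chart_map_cod dq; have cq' := chart_map_cod dq'.
have [r r0 [bU Kcst]] := killing_inv_local ac cq.
have ricb y : box (chart_map c q) r y -> ric (Gm c) y = 0.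
  move=> yb; apply: (ric0_killing_inv ac (bU _ yb)).
  by rewrite (Kcst _ _ (box_center _ r0) yb).
pose E c0 f h y := dot (inv_metric (Gm c0) y) (du (loc f c0) y) (du (loc h c0) y).
have Ecst f h : static_potentials g f -> static_potentials g h ->
    forall y z, box (chart_map c q) r y -> box (chart_map c q) r z ->
    E c f h z = E c f h y.
  move=> pf ph; apply: (partial0_box bU).
    exact: (smooth_dot (openU c) (metric_smooth_mx ac) (metric_pos_mx ac)
      (smooth_du (openU c) (static_loc pf ac))
      (smooth_du (openU c) (static_loc ph ac))).
  move=> y k yb; have cy := bU _ yb.
  rewrite (partial_dot_du (openU c) (metric_smooth_mx ac) (metric_sym_mx ac)
    (metric_pos_mx ac) k (static_loc pf ac) (static_loc ph ac) cy).
  by rewrite ricb // !mulmx0 mxE !mulr0 addr0.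
apply: (killing_inv_eq0 cq') => k f0 h0 f0E h0E.
have [f [pf ->]] : exists f, static_potentials g f /\ f0 = loc f c'.
  by case: f0E => ->; [exists f1|exists f2].
have [h [ph ->]] : exists h, static_potentials g h /\ h0 = loc h c'.
  by case: h0E => ->; [exists f1|exists f2].
rewrite -(partial_dot_du (openU c') (metric_smooth_mx ac') (metric_sym_mx ac')
    (metric_pos_mx ac') k (static_loc pf ac') (static_loc ph ac') cq').
rewrite -[RHS](partial_cst (E c f h (chart_map c q)) k (chart_map c' q)).
apply: near_eq_derive.
have nb := chart_map_near dq (box_nbhs (chart_map c q) r0).
have ncod : nbhs (chart_map c' q) (chart_cod c').
  by apply: open_nbhs_nbhs; split=> //; exact: chart_cod_open.
have nb' := chart_inv_near cq' (A := [set s | chart_dom c s /\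
  box (chart_map c q) r (chart_map c s)]).
rewrite chart_mapK // in nb'.
apply: (filterS _ (filterI ncod (nb' nb))) => y [cy [dy yb]].
rewrite [LHS](dot_du_invariant pf ph ac' ac) //.
by apply: (Ecst f h pf ph) => //; exact: box_center.
Qed.

Lemma flat_of_common_zero q0 : f1 q0 = 0 -> f2 q0 = 0 -> flat g.
Proof.
move=> z1 z2.
(* All charts around [q] are required, so membership can be used in any convenient one;
   [killing_inv_transfer] recovers the others. *)
pose Z : set M := [set q | forall c, atlas c -> chart_dom c q -> kinv c (chart_map c q) = 0].
suff Zall q : Z q.
  apply: flat_of_ric0 => c x ac cx; apply: ric0_killing_inv => //.
  by rewrite -(chart_invK cx); apply: Zall => //; exact: chart_inv_dom.
apply: connected_clopen conM _ _ _ q.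
- exists q0 => c ac dq; rewrite /killing_inv /killing_norm /killing chart_mapK //.
  by rewrite z1 z2 !scale0r subrr /dot !mul0mx mxE mulr0.
- move=> q Zq; have [c ac dq] := atlas_cover q.
  have [r r0 [bU Kcst]] := killing_inv_local ac (chart_map_cod dq).
  have := chart_map_near dq (box_nbhs _ r0); apply: filterS => s [ds bs] c' ac' ds'.
  apply: (killing_inv_transfer ac ac' ds ds').
  by rewrite (Kcst (chart_map c q)) ?Zq //; exact: box_center.
move=> q clq c' ac' dq'; have [c ac dq] := atlas_cover q.
have [r r0 [bU Kcst]] := killing_inv_local ac (chart_map_cod dq).
have [s [Zs [ds bs]]] := clq _ (chart_map_near dq (box_nbhs _ r0)).
apply: (killing_inv_transfer ac ac' dq dq').
by rewrite (Kcst (chart_map c s)) ?Zs //; exact: box_center.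
Qed.

End TwoFunctions.

End Global.

(** * Bounding the dimension *)

Section Dimension.
Variables (R : realType) (M : smooth_manifold R 3) (g : riemannian_metric M).
Hypothesis conM : connected [set: M].
Hypothesis scal0 : zero_scalar_curv g.
Implicit Types f h : M -> R.

(** At a point [q], a potential nonzero at [q] serves as pivot to cancel the values of others, as in
    [f1(q) f2 - f2(q) f1]. The cases differ by which of [f1] and [f2] can be the pivot; if neither,
    they already share the zero. *)
Lemma flat_of_three_independent f1 f2 f3 : static_potentials g f1 ->
  static_potentials g f2 -> static_potentials g f3 ->
  (forall a b d : R, (forall q, a * f1 q + b * f2 q + d * f3 q = 0) ->
     [/\ a = 0, b = 0 & d = 0]) -> flat g.
Proof.
move=> p1 p2 p3 ind; apply: flat_of_ric0 => // c x ac cx.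
set q := chart_inv c x.
have comb f h : static_potentials g f -> static_potentials g h ->
    static_potentials g (fun r => f q * h r + - h q * f r) by move=> *; exact: static_comb.
have zero f h : f q * h q + - h q * f q = 0 by ring.
have [z1|z1] := eqVneq (f1 q) 0; last first.
  apply: (common_zero_ric conM scal0 (comb f1 f2 p1 p2) (comb f1 f3 p1 p3) _ ac cx) => //.
  move=> a b e.
  have [|_ a0 b0] := ind (a * - f2 q + b * - f3 q) (a * f1 q) (b * f1 q).
    by move=> r; rewrite -[RHS](e r); ring.
  by split; apply: (mulIf z1); rewrite mul0r.
have [z2|z2] := eqVneq (f2 q) 0.
  apply: (common_zero_ric conM scal0 p1 p2 _ ac cx) => // a b e.
  have [|a0 b0 _] // := ind a b 0.
  by move=> r; rewrite mul0r addr0 e.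
apply: (common_zero_ric conM scal0 p1 (comb f2 f3 p2 p3) _ ac cx) => // a b e.
have [|a0 _ b0] := ind a (b * - f3 q) (b * f2 q).
  by move=> r; rewrite -[RHS](e r); ring.
by split=> //; apply: (mulIf z2); rewrite mul0r.
Qed.

(** Finite dimensionality is part of the conclusion, so the basis is grown one potential at a time,
    stopping as soon as it spans. *)
Lemma static_dim : ~ flat g -> exists2 d : nat, (d <= 2)%N & has_dim (static_potentials g) d.
Proof.
move=> nflat.
have [all0|/existsNP[f1 /not_implyP[p1 f10]]] :=
    pselect (forall f, static_potentials g f -> f = 0).
  exists 0%N => //; exists [tuple]; split.
  - by case.
  - by move=> a _ [].
  - by move=> v /all0 ->; exists (fun=> 0); rewrite big_ord0.
have f1nz a : a *: f1 = 0 -> a = 0.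
  move=> e; apply: contrapT => /eqP a0; apply: f10.
  by rewrite -[f1]scale1r -(mulVf a0) -scalerA e scaler0.
have [all1|/existsNP[f2 /not_implyP[p2 f20]]] :=
    pselect (forall f, static_potentials g f -> exists a, f = a *: f1).
  exists 1%N => //; exists [tuple f1]; split.
  - by move=> i; rewrite (ord1 i).
  - move=> a; rewrite big_ord1 => /f1nz a0 i; by rewrite (ord1 i).
  - by move=> v /all1[a ->]; exists (fun=> a); rewrite big_ord1.
have ind2 (a b : R) : a *: f1 + b *: f2 = 0 -> a = 0 /\ b = 0.
  move=> e; have [b0|b0] := eqVneq b 0.
    by move: e; rewrite b0 scale0r addr0 => /f1nz ->.
  exfalso; apply: f20; exists (- (b^-1 * a)).
  have : b^-1 *: (a *: f1 + b *: f2) = 0 by rewrite e scaler0.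
  rewrite scalerDr !scalerA mulVf // scale1r => /eqP; rewrite addr_eq0 => /eqP {}e.
  by rewrite scaleNr e opprK.
exists 2%N => //; exists [tuple f1; f2]; split.
- by case=> [[|[|//]] lti] /=.
- move=> a; rewrite big_ord_recl big_ord1 /= => /ind2[a0 a1] i.
  case: i => [[|[|//]] lti].
    by rewrite -a0; congr a; exact: val_inj.
  by rewrite -a1; congr a; exact: val_inj.
(* A potential outside the span of [f1] and [f2] would be a third independent one and force
   flatness. *)
move=> v pv; apply: contrapT => nv; apply: nflat.
apply: (flat_of_three_independent p1 p2 pv) => a b d e.
have E : a *: f1 + b *: f2 + d *: v = 0 by apply/funext => q; exact: e.
have [d0|d0] := eqVneq d 0.
  by move: E; rewrite d0 scale0r addr0 => /ind2[-> ->].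
exfalso; apply: nv.
exists (fun i : 'I_2 => - (d^-1 * (if i == ord0 then a else b))).
rewrite big_ord_recl big_ord1 /=.
have : d^-1 *: (a *: f1 + b *: f2 + d *: v) = 0 by rewrite E scaler0.
rewrite !scalerDr !scalerA mulVf // scale1r addrC => /eqP; rewrite addr_eq0 => /eqP ->.
by rewrite opprD !scaleNr.
Qed.

End Dimension.

Theorem theorem1p3 (R : realType) (M : smooth_manifold R 3)
    (g : riemannian_metric M) :
  connected [set: M] ->
  zero_scalar_curv g ->
  (~ flat g -> exists2 d : nat, (d <= 2)%N & has_dim (static_potentials g) d) /\
  ((exists f1 f2 : M -> R,
      [/\ static_potentials g f1,
          static_potentials g f2,
          lin_indep [tuple f1; f2]
        & (f1 @^-1` [set 0]) `&` (f2 @^-1` [set 0]) !=set0]) ->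
   flat g).
Proof.
move=> conM scal0; split; first exact: static_dim.
case=> f1 [f2 [p1 p2 ind [q [z1 z2]]]].
apply: (flat_of_common_zero conM scal0 p1 p2 _ z1 z2) => a b e.
have I := ind (fun i => if i == ord0 then a else b).
rewrite big_ord_recl big_ord1 /= in I.
have {}I := I (funext e).
by split; [exact: (I ord0)|exact: (I ord_max)].
Qed.
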